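(* Let $d\in\{1,2,3\}$, assume that $v$ and $\omega$ satisfy Condition (C), and additionally that $\omega\in L^\infty_{\mathrm{loc}}(\mathbb{R}^d)$. Then $D(H)\subset D(L^{1/2})$ if and only if $\int\frac{|\hat v(k)|^2}{k^2+\omega(k)}dk<\infty$. Moreover, if $\int\frac{|\hat v(k)|^2}{k^2+\omega(k)}dk=\infty$, then $D(H)\cap D(L^{1/2})=\{0\}$.
   Context: Setting. $d\in\{1,2,3\}$, $M\ge1$ a fixed integer, $g\in\mathbb{R}$ the coupling constant. $\mathscr{H}=\bigoplus_{n\ge0}\mathscr{H}^{(n)}$ with $\mathscr{H}^{(n)}=L^2(\mathbb{R}^{dM})\otimes L^2_{\mathrm{sym}}(\mathbb{R}^{dn})$ (symmetric under permutations of the last $n$ variables in $\mathbb{R}^d$). In Fourier representation write $\hat\psi^{(n)}(P,K)$ with $P=(p_1,\dots,p_M)$, $K=(k_1,\dots,k_n)$; $e_i$ is the inclusion of the $i$-th copy of $\mathbb{R}^d$ in $\mathbb{R}^{dM}$; $\hat K_j$ is $K$ with $k_j$ deleted. $L$ is the self-adjoint operator acting in Fourier representation as multiplication by $L(P,K)=P^2+\sum_{j=1}^n\omega(k_j)$, with its maximal domain $D(L)=\{\psi\in\mathscr{H}: L\psi\in\mathscr{H}\}$; $L^{1/2}$ is defined by functional calculus with its natural domain. Condition (C): $v\in\mathscr{S}'(\mathbb{R}^d)$, $v\notin L^2(\mathbb{R}^d)$, $\omega:\mathbb{R}^d\to\mathbb{R}_+$, and $|\hat v(k)|\le|k|^{-\alpha}$,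 $\omega(k)\ge(1+k^2)^{\beta/2}$ with parameters $0\le\alpha<\frac d2$, $0\le\beta\le2$ satisfying one of: (1) $\alpha>\frac d2-1$ (hence $\int\frac{|\hat v(k)|^2}{k^2+\omega(k)}dk<\infty$); (2) $\int\frac{|\hat v(k)|^2}{k^2+\omega(k)}dk=\infty$ and [$\alpha=0$ and $\beta>0$ if $d=2$; $\alpha>\frac12-\frac{\beta^2}{8+\beta^2}$ if $d=3$]. $G$ is the bounded operator on $\mathscr{H}$ with $(G\psi)^{(0)}=0$ and $\widehat{(G\psi)}^{(n+1)}(P,K)=\frac{-g}{\sqrt{n+1}}\sum_{i=1}^M\sum_{j=1}^{n+1}\frac{\hat v(k_j)\hat\psi^{(n)}(P+e_ik_j,\hat K_j)}{L(P,K)}$, $K\in\mathbb{R}^{d(n+1)}$. $D(H)=\{\psi\in\mathscr{H}:\psi-G\psi\in D(L)\}$; it is the domain of self-adjointness of the Hamiltonian $H$ with formal expression $L+g\sum_{i=1}^M\big(a^*(v(x_i-y))+a(v(x_i-y))\big)$, where $a,a^*$ are the bosonic annihilation and creation operators, $x_i$ are the positions of the $M$ particles and $y$ that of a boson.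
   Formalization: The coupling constant g is assumed nonzero; for g = 0 one has G = 0 and D(H) = D(L) ⊂ D(L^{1/2}), so the claim fails whenever the integral diverges (e.g. d = 3, v̂ = |k|^{-1/2}, ω = (1+k²)^{1/2}). *)

(* Defs.v *)
From HB Require Import structures.
From mathcomp Require Import all_boot all_order all_algebra all_fingroup.
From mathcomp Require Import all_classical all_reals all_analysis.
From mathcomp Require Import complex.

Set Implicit Arguments.
Unset Strict Implicit.
Unset Printing Implicit Defensive.
Import Order.TTheory GRing.Theory Num.Theory.
Import numFieldNormedType.Exports.
Local Open Scope classical_set_scope.
Local Open Scope ring_scope.
Local Open Scope complex_scope.

(* The library has the product sigma-algebra on n.-tuple T but no product
   measure on it. *)
Section tuple_measure.
Context d (T : measurableType d) (R : realType).
Variable mu : {sigma_finite_measure set T -> \bar R}.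

Definition tuple_of_pair n (x : T * n.-tuple T) : n.+1.-tuple T :=
  [tuple of x.1 :: x.2].

Lemma measurable_tuple_of_pair n : measurable_fun setT (@tuple_of_pair n).
Proof. exact: (measurable_cons measurable_fst measurable_snd). Qed.

Section cons_measure.
Variables (n : nat) (nu : {sigma_finite_measure set (n.-tuple T) -> \bar R}).

Definition cons_measure : set (n.+1.-tuple T) -> \bar R :=
  pushforward (mu \x nu)%E (@tuple_of_pair n).

Let cons_measure0 : cons_measure set0 = 0%E.
Proof. by rewrite /cons_measure /pushforward preimage_set0 measure0. Qed.

Let cons_measure_ge0 A : (0 <= cons_measure A)%E.
Proof. by rewrite /cons_measure /pushforward measure_ge0. Qed.

Let cons_measure_sigma_additive : semi_sigma_additive cons_measure.
Proof.
move=> F mF tF mUF; rewrite /cons_measure /pushforward preimage_bigcup.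
apply: measure_semi_sigma_additive.
- by move=> k; rewrite -[X in measurable X]setTI;
    exact: measurable_tuple_of_pair.
- apply/trivIsetP => /= i j _ _ ij; rewrite -preimage_setI.
  by move/trivIsetP : tF => /(_ _ _ _ _ ij) ->//; rewrite preimage_set0.
- by rewrite -preimage_bigcup -[X in measurable X]setTI;
    exact: measurable_tuple_of_pair.
Qed.

HB.instance Definition _ := isMeasure.Build _ _ _ cons_measure
  cons_measure0 cons_measure_ge0 cons_measure_sigma_additive.

Let cons_measure_sigma_finite : sigma_finite setT cons_measure.
Proof.
pose uncons (x : n.+1.-tuple T) : T * n.-tuple T :=
  (thead x, [tuple of behead x]).
have muncons : measurable_fun setT uncons.
  apply: measurable_fun_pair; [exact: measurable_tnth|exact: measurable_behead].
have consK : cancel (@tuple_of_pair n) uncons.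
  by move=> [a t]; congr (_, _); rewrite ?theadE//; apply/val_inj.
have /sigma_finiteP[F [TF ndF Foo]] := sigma_finiteT mu.
have /sigma_finiteP[G [TG ndG Goo]] := sigma_finiteT nu.
exists (fun k => uncons @^-1` (F k `*` G k)).
  rewrite -preimage_bigcup -(preimage_setT uncons); congr (_ @^-1` _).
  rewrite -setXTT TF TG predeqE => -[x y]; split.
    move=> [/= [i _ Fix] [k _ Gky]]; exists (maxn i k) => //; split.
    - by move: x Fix; exact/subsetPset/ndF/leq_maxl.
    - by move: y Gky; exact/subsetPset/ndG/leq_maxr.
  by move=> [i _ []/= ? ?]; split; exists i.
move=> k; have [mFk ?] := Foo k; have [mGk ?] := Goo k; split.
  by rewrite -[X in measurable X]setTI; apply: muncons => //; exact: measurableX.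
rewrite /cons_measure /pushforward -comp_preimage.
rewrite (_ : uncons \o _ = id) ?preimage_id; last first.
  by apply/funext => x /=; exact: consK.
by rewrite product_measure1E// lte_mul_pinfty// ge0_fin_numE.
Qed.

HB.instance Definition _ := Measure_isSigmaFinite.Build _ _ _ cons_measure
  cons_measure_sigma_finite.

End cons_measure.

Fixpoint tuple_measure n : {sigma_finite_measure set (n.-tuple T) -> \bar R} :=
  match n with
  | 0 => @dirac _ (0.-tuple T) [tuple] R
  | n'.+1 => cons_measure (tuple_measure n')
  end.

End tuple_measure.

Section euclidean.
Variables (R : realType) (d : nat).

Definition Rd := d.-tuple (measurableTypeR R).

Definition leb : {sigma_finite_measure set Rd -> \bar R} :=
  tuple_measure (@lebesgue_measure R) d.

Definition dotRd (x y : Rd) : R := \sum_(i < d) tnth x i * tnth y i.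

Definition sqnorm (x : Rd) : R := dotRd x x.

Definition addRd (x y : Rd) : Rd := [tuple tnth x i + tnth y i | i < d].

Definition setcoord (x : Rd) (i : 'I_d) (t : R) : Rd :=
  [tuple if j == i then t else tnth x j | j < d].

End euclidean.

Section complex_valued.
Context (R : realType) (disp : measure_display) (T : measurableType disp).
Variable mu : {measure set T -> \bar R}.
Implicit Type f : T -> R[i].

Definition cmeasurable f :=
  measurable_fun setT (fun x => complex.Re (f x)) /\
  measurable_fun setT (fun x => complex.Im (f x)).

Definition sqnormL2 f : \bar R :=
  (\int[mu]_x ((Normc.normc (f x)) ^+ 2)%:E)%E.

Definition inL2 f := cmeasurable f /\ (sqnormL2 f < +oo)%E.

Definition cintegral f : R[i] :=
  Rintegral mu setT (fun x => complex.Re (f x)) +i*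
  Rintegral mu setT (fun x => complex.Im (f x)).

End complex_valued.

Section tempered_distributions.
Variables (R : realType) (d : nat).
Implicit Type f : Rd R d -> R[i].

Definition partial (i : 'I_d) (h : Rd R d -> R) (x : Rd R d) : R :=
  derive1 (fun t : R => h (setcoord x i t)) (tnth x i).

Definition partials (s : seq 'I_d) (h : Rd R d -> R) : Rd R d -> R :=
  foldr partial h s.

Definition cpartials (s : seq 'I_d) f (x : Rd R d) : R[i] :=
  partials s (fun y => complex.Re (f y)) x +i*
  partials s (fun y => complex.Im (f y)) x.

Definition has_partials (h : Rd R d -> R) :=
  forall (s : seq 'I_d) (i : 'I_d) (x : Rd R d),
    derivable (fun t : R => partials s h (setcoord x i t)) (tnth x i) 1.

Definition seminorm_le (N : nat) (B : R) f :=
  forall (s : seq 'I_d) (x : Rd R d), (size s <= N)%N ->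
    (1 + sqnorm x) ^+ N * Normc.normc (cpartials s f x) <= B.

(* No continuity clause is needed: a function all of whose iterated partial
   derivatives exist and are bounded is of class C^oo. *)
Definition schwartz f :=
  [/\ has_partials (fun x => complex.Re (f x)),
      has_partials (fun x => complex.Im (f x)) &
      forall N, exists B, seminorm_le N B f].

(* A distribution is represented by a map on all functions; only its values on
   Schwartz functions are meaningful. *)
Definition tempered (T : (Rd R d -> R[i]) -> R[i]) :=
  (forall (a : R[i]) f h, schwartz f -> schwartz h ->
     T (fun x => a * f x + h x) = a * T f + T h) /\
  (exists (N : nat) (C : R), forall f (B : R), schwartz f ->
     seminorm_le N B f -> Normc.normc (T f) <= C * B).

Definition represents (u : Rd R d -> R[i]) (T : (Rd R d -> R[i]) -> R[i]) :=
  cmeasurable u /\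
  forall f, schwartz f -> T f = cintegral (leb R d) (fun x => u x * f x).

Definition fourier f (k : Rd R d) : R[i] :=
  ((2 * pi) `^ (- (d%:R / 2)))%:C *
  cintegral (leb R d)
    (fun x => (cos (dotRd k x) -i* sin (dotRd k x)) * f x).

Definition fourier_distr (T : (Rd R d -> R[i]) -> R[i]) :
  (Rd R d -> R[i]) -> R[i] := fun f => T (fourier f).

End tempered_distributions.

Section condition.
Variables (R : realType) (d : nat).
Variables (v : (Rd R d -> R[i]) -> R[i]) (vhat : Rd R d -> R[i]).
Variables (omega : Rd R d -> R).

Definition form_integral : \bar R :=
  (\int[leb R d]_k ((Normc.normc (vhat k)) ^+ 2 / (sqnorm k + omega k))%:E)%E.

Definition condition_parameters (alpha beta : R) :=
  [/\ 0 <= alpha, alpha < d%:R / 2, 0 <= beta & beta <= 2] /\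
  (d%:R / 2 - 1 < alpha \/
   [/\ form_integral = +oo%E,
       d = 2%N -> alpha = 0 /\ 0 < beta &
       d = 3%N -> 1 / 2 - beta ^+ 2 / (8 + beta ^+ 2) < alpha]).

(* The bound on vhat is required almost everywhere, vhat being determined by v
   only up to null sets (and 0 `^ (- alpha) being 0 for alpha != 0). *)
Definition conditionC (alpha beta : R) :=
  [/\ tempered v,
      represents vhat (fourier_distr v),
      ~ (exists u, inL2 (leb R d) u /\ represents u v),
      measurable_fun setT omega /\ (forall k, 0 <= omega k) &
      [/\ {ae leb R d, forall k,
             Normc.normc (vhat k) <= Num.sqrt (sqnorm k) `^ (- alpha)},
          forall k, (1 + sqnorm k) `^ (beta / 2) <= omega k &
          condition_parameters alpha beta]].

Definition locally_bounded :=
  forall r : R, exists C : R,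
    {ae leb R d, forall k, sqnorm k <= r ^+ 2 -> `|omega k| <= C}.

End condition.

Section fock_space.
Variables (R : realType) (d M : nat).

Definition config n : Type := (M.-tuple (Rd R d) * n.-tuple (Rd R d))%type.

Definition config_measure n : {measure set (config n) -> \bar R} :=
  (tuple_measure (leb R d) M \x tuple_measure (leb R d) n)%E.

(* Vectors are given by representatives, in Fourier representation; the sets of
   vectors below are closed under almost-everywhere equality, and [zero_class]
   is the set of all representatives of the zero vector. *)
Definition fock : Type := forall n, config n -> R[i].

Definition permute n (s : 'S_n) (K : n.-tuple (Rd R d)) : n.-tuple (Rd R d) :=
  [tuple tnth K (s j) | j < n].

Definition hilbert : set fock := [set psi |
  [/\ forall n, cmeasurable (psi n),
      forall n (s : 'S_n), {ae config_measure n, forall X,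
        psi n (X.1, permute s X.2) = psi n X} &
      (\sum_(0 <= n <oo) sqnormL2 (config_measure n) (psi n) < +oo)%E]].

Definition zero_class : set fock := [set psi | hilbert psi /\
  forall n, {ae config_measure n, forall X, psi n X = 0}].

Variable omega : Rd R d -> R.

Definition symbolL n (X : config n) : R :=
  \sum_(i < M) sqnorm (tnth X.1 i) + \sum_(j < n) omega (tnth X.2 j).

Definition multiplication (m : forall n, config n -> R) (psi : fock) : fock :=
  fun n X => (m n X)%:C * psi n X.

Definition domL : set fock :=
  [set psi | hilbert psi /\ hilbert (multiplication symbolL psi)].

(* L being a multiplication operator, functional calculus makes its square root
   multiplication by the square root of the symbol. *)
Definition domLhalf : set fock := [set psi | hilbert psi /\
  hilbert (multiplication (fun n X => Num.sqrt (symbolL X)) psi)].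

Variables (g : R) (vhat : Rd R d -> R[i]).

(* shift P i k is P + e_i k. *)
Definition shift (P : M.-tuple (Rd R d)) (i : 'I_M) (k : Rd R d) :
    M.-tuple (Rd R d) :=
  [tuple if l == i then addRd (tnth P l) k else tnth P l | l < M].

Definition delete n (K : n.+1.-tuple (Rd R d)) (j : 'I_n.+1) :
    n.-tuple (Rd R d) :=
  [tuple tnth K (lift j l) | l < n].

Definition opG (psi : fock) : fock := fun n =>
  match n return config n -> R[i] with
  | 0 => fun _ => 0
  | n'.+1 => fun X =>
      (- g / Num.sqrt (n'.+1%:R))%:C *
      \sum_(i < M) \sum_(j < n'.+1)
        vhat (tnth X.2 j) *
        psi n' (shift X.1 i (tnth X.2 j), delete X.2 j) / (symbolL X)%:C
  end.

Definition domH : set fock := [set psi | hilbert psi /\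
  domL (fun n X => psi n X - opG psi X)].

End fock_space.

Arguments domLhalf {R d} M omega _.
Arguments domH {R d} M omega g vhat _.
Arguments zero_class R d M _ : clear implicits.

(* Main.v *)
From HB Require Import structures.
Require Import Defs.
From mathcomp Require Import all_boot all_order all_algebra all_fingroup.
From mathcomp Require Import all_classical all_reals all_analysis.
From mathcomp Require Import complex measurable_realfun.
From mathcomp Require Import ring lra.
Import Order.TTheory GRing.Theory Num.Theory.
Local Open Scope classical_set_scope.
Local Open Scope ring_scope.
Local Open Scope complex_scope.

Set Implicit Arguments.
Unset Strict Implicit.
Unset Printing Implicit Defensive.

(* All estimates rest on the change of variables (P, K) |-> (P + e_i k_j, K
   without k_j, k_j), which preserves Lebesgue measure.
   Cauchy-Schwarz with the weights omega (k_j), whose sum is at most L, bounds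
   |G psi^(n)|^2 by C (n+1)^(-delta) |psi^(n)|^2 under either case of
   Condition (C). If alpha > d/2 - 1, unweighted Cauchy-Schwarz bounds
   |L^(1/2) G psi^(n)|^2 by C (n+1) |psi^(n)|^2. The decay of G in n and
   psi - G psi in D(L) give summability of n |psi^(n)|^2, hence
   D(H) is contained in D(L^(1/2)).
   Conversely, psi in both domains forces L^(1/2) G psi to be square
   integrable. On the region where |k_1| >= 1 while the configuration left
   after particle 1 absorbs k_1 stays bounded, L is comparable to
   k_1^2 + omega (k_1), and the term (i, j) = (1, 1) of G psi contributes the
   form integral times the mass of psi^(n) on a bounded set. Every other term
   contributes a finite amount there, because the momentum integrated out is
   confined to a ball. So psi = 0 when the form integral diverges.
   That D(H) is not {0} follows by iterating G on a vacuum vector: the decay of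
   G makes the Neumann series converge. *)

(** * Lebesgue measure on tuples *)

(** The exponent delta is drawn from the strict inequality d/2 < alpha + beta/2 + 1, which both
    cases of Condition (C) imply. After Cauchy-Schwarz one factor 1/L is left, and it is split as
    (n+1)^(-delta) (1 + p_i^2)^(-(1 - delta)). In the new variables p_i equals q_i - k, so what must
    be bounded uniformly in q_i is the integral over k of |k|^(-2 alpha) (1 + k^2)^(-beta/2) (1 +
    (q_i - k)^2)^(-(1 - delta)); the strict inequality leaves room for a small delta. Boundedness of
    G alone would not close the recursion in n: comparing psi with psi - G psi costs factors 2, and
    the sums stay bounded because the coefficient of the recursion is eventually at most 1/2. In the
    divergent case the danger is cancellation between the terms of G psi. The cutoff region is
    chosen so that the remaining terms are integrable there and cannot compensate a divergent
    one. *)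

Lemma measurable_ext d1 d2 (T1 : sigmaRingType d1) (T2 : sigmaRingType d2)
    (D : set T1) (f h : T1 -> T2) :
  measurable_fun D f -> f =1 h -> measurable_fun D h.
Proof. by move=> mf /funext <-. Qed.

Section tuple_integral.
Context d (T : measurableType d) (R : realType).
Variable mu : {sigma_finite_measure set T -> \bar R}.
Local Open Scope ereal_scope.
Local Notation tm := (tuple_measure mu).

Definition tuple_delete n (K : n.+1.-tuple T) (j : 'I_n.+1) : n.-tuple T :=
  [tuple tnth K (lift j l) | l < n].

Definition tuple_permute n (s : 'S_n) (K : n.-tuple T) : n.-tuple T :=
  [tuple tnth K (s j) | j < n].

Lemma measurable_tuple_delete n (j : 'I_n.+1) :
  measurable_fun setT (fun K : n.+1.-tuple T => tuple_delete K j).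
Proof.
apply/measurable_fun_tnthP => l.
by apply: (measurable_ext (measurable_tnth (lift j l))) => K /=; rewrite tnth_mktuple.
Qed.

Lemma measurable_tuple_permute n (s : 'S_n) :
  measurable_fun setT (tuple_permute s).
Proof.
apply/measurable_fun_tnthP => l.
by apply: (measurable_ext (measurable_tnth (s l))) => K /=; rewrite tnth_mktuple.
Qed.

Lemma integral_tuple_measureS n (f : n.+1.-tuple T -> \bar R) :
  measurable_fun setT f -> (forall x, 0 <= f x) ->
  \int[tm n.+1]_t f t = \int[mu \x tm n]_z f (tuple_of_pair z).
Proof.
move=> mf f0.
rewrite -[setT in RHS](preimage_setT (@tuple_of_pair _ T n)).
by rewrite -(ge0_integral_pushforward (@measurable_tuple_of_pair _ T n)).
Qed.

Lemma tuple_delete_cons0 n (x : T) (t : n.-tuple T) :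
  tuple_delete (tuple_of_pair (x, t)) ord0 = t.
Proof. by apply: eq_from_tnth => i; rewrite tnth_mktuple tnthS. Qed.

Lemma tuple_delete_consS n (x : T) (t : n.+1.-tuple T) (j : 'I_n.+1) :
  tuple_delete (tuple_of_pair (x, t)) (lift ord0 j) =
  tuple_of_pair (x, tuple_delete t j).
Proof.
apply: eq_from_tnth => i; rewrite tnth_mktuple.
have [l ->|->] := unliftP ord0 i.
  rewrite [RHS]tnthS tnth_mktuple.
  rewrite (_ : lift (lift ord0 j) (lift ord0 l) = lift ord0 (lift j l)).
    by rewrite [LHS]tnthS.
  by apply/val_inj; rewrite /= /bump !leq0n !add1n ltnS addnS.
by rewrite (_ : lift (lift ord0 j) ord0 = ord0) ?tnth0 //; apply/val_inj.
Qed.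

(** Induction on [n]. If the extracted coordinate is not the head, the head is frozen while the
    induction hypothesis extracts the coordinate from the tail; Tonelli then exchanges the two. *)
Lemma integral_tuple_delete n (j : 'I_n.+1) (f : T * n.-tuple T -> \bar R) :
  measurable_fun setT f -> (forall x, 0 <= f x) ->
  \int[tm n.+1]_K f (tnth K j, tuple_delete K j) = \int[mu \x tm n]_z f z.
Proof.
elim: n j f => [|n IH] j f mf f0.
  rewrite ord1 integral_tuple_measureS//; last first.
    apply: measurableT_comp => //; apply: measurable_fun_pair => /=.
      exact: measurable_tnth.
    exact: measurable_tuple_delete.
  by apply: eq_integral => -[x t] _; rewrite tuple_delete_cons0.
have mg m i : measurable_fun setT
    (fun K : m.+1.-tuple T => (tnth K i, tuple_delete K i)).
  apply: measurable_fun_pair => /=; first exact: measurable_tnth.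
  exact: measurable_tuple_delete.
rewrite integral_tuple_measureS//; last exact: measurableT_comp (mg _ _).
have [l ->|->] := unliftP ord0 j; last first.
  by apply: eq_integral => -[x t] _; rewrite tuple_delete_cons0.
pose F (z : (T * T) * n.-tuple T) := f (z.1.2, tuple_of_pair (z.1.1, z.2)).
have mF : measurable_fun setT F.
  apply: (measurableT_comp mf); apply: measurable_fun_pair => /=.
    exact: measurableT_comp measurable_snd measurable_fst.
  apply: (measurableT_comp (@measurable_tuple_of_pair _ T n)).
  by apply: measurable_fun_pair => //=; exact: measurableT_comp measurable_fst measurable_fst.
have F0 z : 0 <= F z by exact: f0.
transitivity (\int[mu]_x \int[mu]_k \int[tm n]_t F ((x, k), t)).
  rewrite fubini_tonelli1//; last first.
    apply: measurableT_comp => //.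
    exact: (measurableT_comp (mg _ _) (@measurable_tuple_of_pair _ T n.+1)).
  apply: eq_integral => x _; rewrite /fubini_F.
  have mFx : measurable_fun setT (fun z : T * n.-tuple T => F (x, z.1, z.2)).
    apply: (measurableT_comp mF); apply: measurable_fun_pair => //=.
    exact: measurable_fun_pair.
  have := IH l (fun z => F (x, z.1, z.2)) mFx (fun z => F0 _).
  rewrite fubini_tonelli1// => <-.
  by apply: eq_integral => t _; rewrite tuple_delete_consS /F/= tnthS.
have mG : measurable_fun setT (fun xk => \int[tm n]_t F (xk, t)).
  exact: (measurable_fun_fubini_tonelli_F (m2 := tm n) F mF F0).
rewrite (fubini_tonelli (m1 := mu) (m2 := mu)
  (fun xk => \int[tm n]_t F (xk, t)))//; last first.
  by move=> z; apply: integral_ge0 => t _.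
rewrite [RHS]fubini_tonelli1//; apply: eq_integral => k _; rewrite /fubini_F.
have mfk : measurable_fun setT (fun t => f (k, t)) by exact: measurableT_comp.
rewrite integral_tuple_measureS// fubini_tonelli1//.
exact: measurableT_comp mfk (@measurable_tuple_of_pair _ T n).
Qed.

(** The map [s] after [lift j] avoids the value [s j], so it factors through [lift (s j)]; the
    factor is [s']. *)
Lemma tuple_delete_permute n (s : 'S_n.+1) (j : 'I_n.+1) : exists s' : 'S_n,
  forall K : n.+1.-tuple T, tuple_delete (tuple_permute s K) j =
    tuple_permute s' (tuple_delete K (s j)).
Proof.
(* The default [l] is never taken: by injectivity of [s], [s (lift j l)] differs from [s j]. *)
pose f (l : 'I_n) := odflt l (unlift (s j) (s (lift j l))).
have fE l : lift (s j) (f l) = s (lift j l).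
  rewrite /f; case: unliftP => [m -> //|/perm_inj /eqP].
  by rewrite eq_sym (negbTE (neq_lift _ _)).
have finj : injective f.
  by move=> a b ab; apply: (@lift_inj _ j); apply: (@perm_inj _ s); rewrite -!fE ab.
exists (perm finj) => K; apply: eq_from_tnth => l.
by rewrite !tnth_mktuple permE fE.
Qed.

(** The head of the permuted tuple is coordinate [s ord0] of the original one. Extracting it leaves
    a permutation of the other coordinates, to which the induction applies. *)
Lemma integral_tuple_permute n (s : 'S_n) (f : n.-tuple T -> \bar R) :
  measurable_fun setT f -> (forall x, 0 <= f x) ->
  \int[tm n]_K f (tuple_permute s K) = \int[tm n]_K f K.
Proof.
elim: n s f => [|n IH] s f mf f0.
  by apply: eq_integral => K _; congr f; apply: eq_from_tnth => -[].
have [s' s'E] := tuple_delete_permute s ord0.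
have consE (K : n.+1.-tuple T) : K = tuple_of_pair (tnth K ord0, tuple_delete K ord0).
  apply: eq_from_tnth => i.
  by have [l ->|->] := unliftP ord0 i; rewrite ?tnth0// [RHS]tnthS tnth_mktuple.
pose g (z : T * n.-tuple T) := f (tuple_of_pair (z.1, tuple_permute s' z.2)).
have mg : measurable_fun setT g.
  apply: (measurableT_comp mf); apply: (measurableT_comp (@measurable_tuple_of_pair _ T n)).
  apply: measurable_fun_pair => //=.
  by apply: measurableT_comp => //; exact: measurable_tuple_permute.
transitivity (\int[tm n.+1]_K g (tnth K (s ord0), tuple_delete K (s ord0))).
  apply: eq_integral => K _; rewrite /g/= -s'E.
  by rewrite [in LHS](consE (tuple_permute s K)) tnth_mktuple.
have mfx x : measurable_fun setT (fun t => f (tuple_of_pair (x, t))).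
  apply: (measurableT_comp mf).
  exact: measurableT_comp (@measurable_tuple_of_pair _ T n) _.
have g0 z : 0 <= g z by exact: f0.
rewrite (integral_tuple_delete (s ord0) mg)//.
rewrite (integral_tuple_measureS mf)// fubini_tonelli1// fubini_tonelli1//; last first.
  exact: measurableT_comp mf (@measurable_tuple_of_pair _ T n).
by apply: eq_integral => x _; exact: (IH s' (fun t => f (tuple_of_pair (x, t)))).
Qed.

Lemma tuple_measure_cube n (A : set T) : measurable A ->
  measurable [set t : n.-tuple T | forall i, A (tnth t i)] /\
  tm n [set t | forall i, A (tnth t i)] = (mu A) ^+ n.
Proof.
move=> mA.
have mC m : measurable [set t : m.-tuple T | forall i, A (tnth t i)].
  rewrite (_ : [set _ | _] = \bigcap_(i in [set: 'I_m])
    ((fun t : m.-tuple T => tnth t i) @^-1` A)).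
    apply: fin_bigcap_measurable => // i _.
    by rewrite -[X in measurable X]setTI; exact: measurable_tnth.
  by apply/seteqP; split=> t /= => [h i _|h i]; exact: h.
split; first exact: mC.
elim: n => [|n IH].
  rewrite expe0 /= /dirac/= indicE mem_set//= => -[] //.
rewrite expeS -IH -product_measure1E//; last exact: mC.
rewrite /cons_measure /pushforward; congr ((mu \x tm n) _).
apply/seteqP; split=> -[x t] /=.
  move=> h; split; first by have := h ord0; rewrite tnth0.
  by move=> i; have := h (lift ord0 i); rewrite tnthS.
by move=> [h1 h2] i; have [l ->|->] := unliftP ord0 i; rewrite ?tnth0// tnthS.
Qed.

End tuple_integral.

(** * Measure-preserving maps, shears and translations *)

Section tuple_map.
Context d (T : measurableType d) (R : realType).
Variable mu : {sigma_finite_measure set T -> \bar R}.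
Local Open Scope ereal_scope.
Local Notation tm := (tuple_measure mu).

(** Invariance is phrased through integrals of nonnegative functions, the form in which it combines
    with Tonelli. *)
Definition preserves_integral (S : T -> T) := forall f : T -> \bar R,
  measurable_fun setT f -> (forall x, 0 <= f x) ->
  \int[mu]_x f (S x) = \int[mu]_x f x.

Lemma integral_tuple_map n (S : 'I_n -> T -> T) (f : n.-tuple T -> \bar R) :
  (forall i, measurable_fun setT (S i)) ->
  (forall i, preserves_integral (S i)) ->
  measurable_fun setT f -> (forall x, 0 <= f x) ->
  \int[tm n]_t f [tuple S i (tnth t i) | i < n] = \int[tm n]_t f t.
Proof.
elim: n S f => [|n IH] S f mS pS mf f0.
  by apply: eq_integral => K _; congr f; apply: eq_from_tnth => -[].
have mmap m (S' : 'I_m -> T -> T) : (forall i, measurable_fun setT (S' i)) ->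
    measurable_fun setT (fun t : m.-tuple T => [tuple S' i (tnth t i) | i < m]).
  move=> mS'; apply/measurable_fun_tnthP => l.
  have : measurable_fun setT (fun t : m.-tuple T => S' l (tnth t l)).
    exact: measurableT_comp (mS' l) (measurable_tnth l).
  by move/measurable_ext; apply => K /=; rewrite tnth_mktuple.
pose S' i := S (lift ord0 i).
pose g (x : T) := \int[tm n]_t f (tuple_of_pair (x, t)).
have mfp : measurable_fun setT (f \o @tuple_of_pair _ T n).
  exact: measurableT_comp mf (@measurable_tuple_of_pair _ T n).
have mg : measurable_fun setT g.
  exact: (measurable_fun_fubini_tonelli_F (m2 := tm n) _ mfp (fun _ => f0 _)).
have mfS : measurable_fun setT
    (fun t : n.+1.-tuple T => f [tuple S i (tnth t i) | i < n.+1]).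
  exact: measurableT_comp mf (mmap _ _ mS).
rewrite (integral_tuple_measureS mu mf)// (integral_tuple_measureS mu mfS)//.
have mfSp : measurable_fun setT
    (fun z => f [tuple S i (tnth (@tuple_of_pair _ T n z) i) | i < n.+1]).
  exact: measurableT_comp mfS (@measurable_tuple_of_pair _ T n).
rewrite (fubini_tonelli1 _ mfSp (fun z => f0 _)).
rewrite (fubini_tonelli1 _ mfp (fun z => f0 _)).
have g0 x : 0 <= g x by apply: integral_ge0 => t _; exact: f0.
rewrite -[RHS](pS ord0 g mg g0).
apply: eq_integral => x _; rewrite /fubini_F /g.
rewrite -(IH S' (fun t => f (tuple_of_pair (S ord0 x, t))))//; last first.
- exact: measurableT_comp mfp _.
- by move=> i; exact: pS.
- by move=> i; exact: mS.
apply: eq_integral => t _; congr f; apply: eq_from_tnth => i.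
rewrite tnth_mktuple; have [l ->|->] := unliftP ord0 i.
  by rewrite [in LHS]tnthS [RHS]tnthS tnth_mktuple.
by rewrite !tnth0.
Qed.

End tuple_map.

Section shear.
Context d1 d2 (T : measurableType d1) (T' : measurableType d2) (R : realType).
Variable mu : {sigma_finite_measure set T -> \bar R}.
Variable nu : {sigma_finite_measure set T' -> \bar R}.
Local Open Scope ereal_scope.
Local Notation tm := (tuple_measure mu).

(** The shift of P depends on k but not conversely, so for fixed k it is a measure-preserving map of
    P alone. Tonelli brings the integral over P inside, invariance removes the shift, and Tonelli
    restores the order. *)
Lemma integral_shear (S : T' -> T -> T') n (j : 'I_n.+1)
    (f : (T' * n.-tuple T) * T -> \bar R) :
  measurable_fun setT (fun z : T' * T => S z.1 z.2) ->
  (forall k, preserves_integral nu (S ^~ k)) ->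
  measurable_fun setT f -> (forall z, 0 <= f z) ->
  \int[nu \x tm n.+1]_X
     f ((S X.1 (tnth X.2 j), tuple_delete X.2 j), tnth X.2 j) =
  \int[nu \x tm n]_Y \int[mu]_k f (Y, k).
Proof.
move=> mS pS mf f0.
have mk : measurable_fun setT (fun X : T' * n.+1.-tuple T => tnth X.2 j).
  exact: measurableT_comp (measurable_tnth j) measurable_snd.
have mLHS : measurable_fun setT (fun X : T' * n.+1.-tuple T =>
    f ((S X.1 (tnth X.2 j), tuple_delete X.2 j), tnth X.2 j)).
  apply: (measurableT_comp mf); apply: measurable_fun_pair => //=.
  apply: measurable_fun_pair => /=.
    apply: (measurableT_comp mS (_ : measurable_fun setT
      (fun X : T' * n.+1.-tuple T => (X.1, tnth X.2 j)))).
    exact: measurable_fun_pair.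
  exact: measurableT_comp (@measurable_tuple_delete _ T n j) measurable_snd.
have mG : measurable_fun setT (fun Y => \int[mu]_k f (Y, k)).
  exact: (measurable_fun_fubini_tonelli_F (m2 := mu) _ mf f0).
have G0 Y : 0 <= \int[mu]_k f (Y, k) by apply: integral_ge0 => k _; exact: f0.
rewrite (fubini_tonelli1 _ mLHS (fun X => f0 _)) (fubini_tonelli1 _ mG G0).
pose F (z : (T' * T) * n.-tuple T) := f ((z.1.1, z.2), z.1.2).
have mF : measurable_fun setT F.
  apply: (measurableT_comp mf); apply: measurable_fun_pair => /=.
    apply: measurable_fun_pair => //=.
    exact: measurableT_comp measurable_fst measurable_fst.
  exact: measurableT_comp measurable_snd measurable_fst.
have F0 z : 0 <= F z by exact: f0.
(* The other coordinates are integrated out first: the shift does not act on them. *)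
pose H (z : T' * T) := \int[tm n]_K F (z, K).
have mH : measurable_fun setT H.
  exact: (measurable_fun_fubini_tonelli_F (m2 := tm n) F mF F0).
have H0 z : 0 <= H z by apply: integral_ge0 => K _; exact: F0.
pose HS (z : T' * T) := H (S z.1 z.2, z.2).
have mHS : measurable_fun setT HS.
  by apply: (measurableT_comp mH); exact: measurable_fun_pair.
have HS0 z : 0 <= HS z by exact: H0.
transitivity (\int[nu]_P \int[mu]_k HS (P, k)).
  apply: eq_integral => P _; rewrite /fubini_F.
  pose h (z : T * n.-tuple T) := f ((S P z.1, z.2), z.1).
  have mh : measurable_fun setT h.
    apply: (measurableT_comp mf); apply: measurable_fun_pair => //=.
    apply: measurable_fun_pair => //=.
    exact: measurableT_comp (measurableT_comp mS (pair1_measurable P)) measurable_fst.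
  exact: (eq_trans (integral_tuple_delete mu j mh (fun z => f0 _))
                   (fubini_tonelli1 h mh (fun z => f0 _))).
apply: (eq_trans (fubini_tonelli (m1 := nu) (m2 := mu) HS mHS HS0)).
transitivity (\int[mu]_k \int[nu]_P H (P, k)).
  apply: eq_integral => k _; apply: (pS k (fun P => H (P, k))).
    exact: measurableT_comp mH (pair2_measurable k).
  by move=> P; exact: H0.
apply: (eq_trans (esym (fubini_tonelli (m1 := nu) (m2 := mu) H mH H0))).
apply: eq_integral => P _; rewrite /fubini_F.
pose h (z : T * n.-tuple T) := f ((P, z.2), z.1).
have mh : measurable_fun setT h.
  apply: (measurableT_comp mf); apply: measurable_fun_pair => //=.
  exact: measurable_fun_pair.
exact: (fubini_tonelli (m1 := mu) (m2 := tm n) h mh (fun z => f0 _)).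
Qed.

End shear.

Section translation.
Variable R : realType.

(** By uniqueness of Lebesgue measure it suffices that the image measure gives half-open intervals
    their length. *)
Lemma lebesgue_preserves_translation (a : R) :
  preserves_integral (@lebesgue_measure R) (fun x : measurableTypeR R => x + a).
Proof.
move=> f mf f0.
have mD : measurable_fun setT (fun x : measurableTypeR R => (x + a : measurableTypeR R)).
  exact: measurable_funD.
pose h : {mfun (measurableTypeR R) >-> (measurableTypeR R)} :=
  HB.pack (fun x : measurableTypeR R => (x + a : measurableTypeR R)) (isMeasurableFun.Build _ _ _ _ _ mD).
have E A : measurable A -> pushforward (@lebesgue_measure R) h A = lebesgue_measure A.
  move=> mA; apply/esym/lebesgue_measure_unique => //= _ [[x y]] _ <-.
  rewrite /pushforward.
  rewrite (_ : h @^-1` _ = `]x - a, y - a]%classic); last first.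
    by apply/seteqP; split=> t /=; rewrite !in_itv/= ltrBlDr lerBrDr.
  rewrite !lebesgue_measure_itv/= !lte_fin ltrD2r; case: ifP => // _.
  by rewrite -!EFinB; congr EFin; ring.
transitivity (\int[pushforward (@lebesgue_measure R) h]_x f x)%E.
  by rewrite (ge0_integral_pushforward mD)//= preimage_setT.
by apply: eq_measure_integral => //= A mA _; exact: E.
Qed.

Lemma leb_preserves_translation d (a : Rd R d) :
  preserves_integral (leb R d) (fun x => addRd x a).
Proof.
move=> f mf f0; pose S i (x : measurableTypeR R) : measurableTypeR R := x + tnth a i.
rewrite -[RHS](@integral_tuple_map _ _ _ (@lebesgue_measure R) d S f)//.
- by move=> i; exact: measurable_funD.
- by move=> i; exact: lebesgue_preserves_translation.
Qed.

End translation.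

(** * Integrals over R^d *)

Lemma measurable_sum_fun d (T : measurableType d) (R : realType) (I : Type)
    (s : seq I) (P : pred I) (f : I -> T -> R) :
  (forall i, measurable_fun setT (f i)) ->
  measurable_fun setT (fun x => \sum_(i <- s | P i) f i x).
Proof.
move=> mf; elim: s => [|i s IH].
  by under eq_fun do rewrite big_nil; exact: measurable_cst.
under eq_fun do rewrite big_cons; case: (P i) => //.
exact: measurable_funD.
Qed.

Lemma measurable_powR_fun d (T : measurableType d) (R : realType) (f : T -> R) p :
  measurable_fun setT f -> measurable_fun setT (fun x => f x `^ p).
Proof. by move=> mf; exact: measurableT_comp (measurable_powR p) mf. Qed.

Lemma measurable_invr_fun d (T : measurableType d) (R : realType) (f : T -> R) :
  (forall x, 0 <= f x) -> measurable_fun setT f ->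
  measurable_fun setT (fun x => (f x)^-1).
Proof.
move=> f0 mf; apply: (measurable_ext (measurable_powR_fun (-1) mf)) => x.
by rewrite powR_inv1.
Qed.

Lemma measurable_sqrt_fun d (T : measurableType d) (R : realType) (f : T -> R) :
  (forall x, 0 <= f x) -> measurable_fun setT f ->
  measurable_fun setT (fun x => Num.sqrt (f x)).
Proof.
move=> f0 mf; apply: (measurable_ext (measurable_powR_fun 2^-1 mf)) => x.
by rewrite powR12_sqrt.
Qed.

Lemma measurable_bool_fun d (T : measurableType d) (R : realType) (b : T -> bool) :
  measurable_fun setT b -> measurable_fun setT (fun x => (b x)%:R : R).
Proof.
move=> mb; have m1 : measurable (b @^-1` [set true]).
  by rewrite -[X in measurable X]setTI; exact: mb.
apply: (@measurable_ext _ _ _ _ _ (\1_(b @^-1` [set true]) : T -> R)) => [|x].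
  exact: measurable_indic.
rewrite indicE; congr (nat_of_bool _)%:R.
by apply/idP/idP => [/set_mem|bx]//; exact/mem_set.
Qed.

Lemma nneseries_le_bound (R : realType) (a : nat -> \bar R) (B : \bar R) :
  (forall n, 0 <= a n)%E -> (forall n, \sum_(0 <= i < n) a i <= B)%E ->
  (\sum_(0 <= i <oo) a i <= B)%E.
Proof.
move=> a0 aB; apply: lime_le; first exact: is_cvg_nneseries.
exact: nearW.
Qed.

Lemma geometric_sum_le (R : realType) (q : R) n : 0 <= q < 1 ->
  \sum_(0 <= j < n) q ^+ j <= (1 - q)^-1.
Proof.
move=> /andP[q0 q1]; have q1' : 0 < 1 - q by rewrite subr_gt0.
rewrite -[leRHS]mul1r ler_pdivlMr//.
suff -> : (\sum_(0 <= j < n) q ^+ j) * (1 - q) = 1 - q ^+ n.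
  by rewrite lerBlDr lerDl exprn_ge0.
elim: n => [|n IH]; first by rewrite big_geq// mul0r expr0 subrr.
by rewrite big_nat_recr//= mulrDl IH exprS; ring.
Qed.

(** Picks the dyadic shell of a momentum; it is applied with base 4 because momenta enter through
    their squared norm. *)
Lemma exp_bracket (R : realType) (b : nat) (y : R) : (1 < b)%N -> 1 <= y ->
  exists j, b%:R ^+ j <= y < b%:R ^+ j.+1.
Proof.
move=> b1 y1.
have ex : exists n, y < b%:R ^+ n.
  have [n yn] : exists n : nat, y < n%:R.
    by exists (Num.bound y); rewrite archi_boundP// (le_trans ler01 y1).
  by exists n; rewrite (lt_le_trans yn)// -natrX ler_nat ltnW// ltn_expl.
case: (ex_minnP ex) => -[|j] yj jmin.
  by move: yj; rewrite expr0 ltNge y1.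
exists j; rewrite yj andbT leNgt; apply/negP => /jmin.
by rewrite ltnn.
Qed.

Lemma ltr_powR (R : realType) (b x y : R) : 1 < b -> x < y -> b `^ x < b `^ y.
Proof.
move=> b1 xy; have b0 : 0 < b by apply: lt_trans b1.
by rewrite /powR gt_eqF// ltr_expR ltr_pM2r// ln_gt0.
Qed.

Lemma powR4 (R : realType) (a : R) : 4 `^ a = 2 `^ (2 * a).
Proof.
have -> : (4 : R) = 2 ^+ 2 by rewrite -natrX.
by rewrite -powR_mulrn// -powRrM.
Qed.

Lemma powR_exprn (R : realType) (b a : R) j : 0 <= b ->
  (b ^+ j) `^ a = (b `^ a) ^+ j.
Proof. by move=> b0; rewrite -(powR_mulrn j b0) powRAC powR_mulrn// powR_ge0. Qed.

Lemma ge0_integral_lin e (T : measurableType e) (R : realType)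
    (mu : {measure set T -> \bar R}) (c : R) (f1 f2 f3 : T -> \bar R) : 0 <= c ->
  measurable_fun setT f1 -> measurable_fun setT f2 -> measurable_fun setT f3 ->
  (forall x, 0 <= f1 x)%E -> (forall x, 0 <= f2 x)%E -> (forall x, 0 <= f3 x)%E ->
  (\int[mu]_x (f1 x + c%:E * (f2 x + f3 x)) =
   \int[mu]_x f1 x + c%:E * (\int[mu]_x f2 x + \int[mu]_x f3 x))%E.
Proof.
move=> c0 m1 m2 m3 f10 f20 f30.
have m23 : measurable_fun setT (fun k => f2 k + f3 k)%E by exact: emeasurable_funD.
have f230 x : (0 <= f2 x + f3 x)%E by exact: adde_ge0.
rewrite ge0_integralD//; last 2 first.
- by move=> k _; rewrite mule_ge0.
- exact: measurable_funeM.
by rewrite ge0_integralZl_EFin// ge0_integralD.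
Qed.

(** Of two negative powers the one with the smaller base is larger, so both factors may be moved to
    the smaller base. A product of decays thereby becomes a sum, and no Young or Hoelder inequality
    is needed for the convolution. *)
Lemma powR_mul_le (R : realType) (x y u s : R) : 1 <= x -> 1 <= y -> 0 <= u -> 0 <= s ->
  x `^ (- u) * y `^ (- s) <= x `^ (- (u + s)) + y `^ (- (u + s)).
Proof.
move=> x1 y1 u0 s0.
have x0 : 0 < x by exact: lt_le_trans x1.
have y0 : 0 < y by exact: lt_le_trans y1.
have powD z : 0 < z -> z `^ (- (u + s)) = z `^ (- u) * z `^ (- s).
  by move=> z0; rewrite opprD powRD// (gt_eqF z0) implybT.
have mono z t e : 0 < z -> z <= t -> 0 <= e -> t `^ (- e) <= z `^ (- e).
  move=> z0 zt e0; have t0 := lt_le_trans z0 zt.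
  rewrite !powRN lef_pV2 ?posrE ?powR_gt0//.
  by apply: ge0_ler_powR => //; rewrite nnegrE ltW.
rewrite !powD//; have [xy|/ltW yx] := leP x y.
  by apply: ler_wpDr; rewrite ?mulr_ge0 ?powR_ge0// ler_wpM2l ?powR_ge0// mono.
by apply: ler_wpDl; rewrite ?mulr_ge0 ?powR_ge0// ler_wpM2r ?powR_ge0// mono.
Qed.

Lemma powR_opp_le1 (R : realType) (z e : R) : 1 <= z -> 0 <= e -> z `^ (- e) <= 1.
Proof.
move=> z1 e0; apply: le_trans (_ : z `^ 0 <= 1); last by rewrite powRr0.
by apply: ler_powR => //; rewrite oppr_le0.
Qed.

(** For [x] at most 1 only the singular factor is kept, the others being at most 1. For [x] above 1,
    [1 + x] is at most [2 * x], whence the factor 2^a, and the singular factor turns into decay. *)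
Lemma kernel_pointwise (R : realType) (a b s x y : R) :
  0 <= a -> 0 <= b -> 0 <= s -> 0 <= x -> 0 <= y ->
  x `^ (- a) * (1 + x) `^ (- b) * (1 + y) `^ (- s) <=
  (x <= 1)%R%:R * x `^ (- a) +
  2 `^ a * ((1 + x) `^ (- (a + b + s)) + (1 + y) `^ (- (a + b + s))).
Proof.
move=> a0 b0 s0 x0 y0.
have x1 : 1 <= 1 + x by rewrite lerDl.
have y1 : 1 <= 1 + y by rewrite lerDl.
have xp : 0 < 1 + x by exact: lt_le_trans x1.
have [xl|xl] := boolP (x <= 1).
  rewrite mul1r; apply: ler_wpDr.
    by rewrite mulr_ge0 ?addr_ge0 ?powR_ge0.
  rewrite -mulrA ler_piMr ?powR_ge0//.
  by rewrite mulr_ile1 ?powR_ge0 ?powR_opp_le1.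
rewrite mul0r add0r.
have xg : 1 < x by rewrite ltNge.
have xp' : 0 < x by exact: lt_trans xg.
have xa : x `^ (- a) <= 2 `^ a * (1 + x) `^ (- a).
  rewrite !powRN ler_pdivlMr ?powR_gt0// ler_pdivrMl ?powR_gt0//.
  rewrite -powRM ?(ltW xp')//; apply: ge0_ler_powR => //.
  - by rewrite nnegrE ltW.
  - by rewrite nnegrE mulr_ge0// ltW.
  - by rewrite mulr_natr mulr2n lerD2r ltW.
apply: (@le_trans _ _ (2 `^ a * ((1 + x) `^ (- (a + b)) * (1 + y) `^ (- s)))).
  have -> : (1 + x) `^ (- (a + b)) = (1 + x) `^ (- a) * (1 + x) `^ (- b).
    by rewrite opprD powRD// (gt_eqF xp) implybT.
  by rewrite !mulrA ler_wpM2r ?powR_ge0// ler_wpM2r ?powR_ge0.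
rewrite ler_wpM2l ?powR_ge0//; apply: powR_mul_le => //.
exact: addr_ge0.
Qed.

Section Rd_integrals.
Variables (R : realType) (d : nat).
Implicit Types (k q : Rd R d).

Definition subRd k q : Rd R d := [tuple tnth k i - tnth q i | i < d].

Lemma sqnormE k : sqnorm k = \sum_(i < d) tnth k i ^+ 2.
Proof. by apply: eq_bigr => i _; rewrite expr2. Qed.

Lemma sqnorm_ge0 k : 0 <= sqnorm k.
Proof. by rewrite sqnormE sumr_ge0// => i _; exact: sqr_ge0. Qed.

Lemma coord_le_sqnorm k i : tnth k i ^+ 2 <= sqnorm k.
Proof.
rewrite sqnormE (bigD1 i)//= lerDl sumr_ge0// => j _; exact: sqr_ge0.
Qed.

Section measurability.
Context e (T : measurableType e).
Implicit Types f h : T -> Rd R d.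

Lemma measurable_sqnorm f : measurable_fun setT f ->
  measurable_fun setT (fun x => sqnorm (f x)).
Proof.
move=> mf; apply: measurable_sum_fun => i.
have mi : measurable_fun setT (fun x => tnth (f x) i).
  exact: measurableT_comp (measurable_tnth i) mf.
exact: measurable_funM.
Qed.

Lemma measurable_addRd f h : measurable_fun setT f -> measurable_fun setT h ->
  measurable_fun setT (fun x => addRd (f x) (h x)).
Proof.
move=> mf mh; apply/measurable_fun_tnthP => i.
have : measurable_fun setT (fun x => tnth (f x) i + tnth (h x) i).
  by apply: measurable_funD; apply: (measurableT_comp (measurable_tnth i)).
by move/measurable_ext; apply => x /=; rewrite tnth_mktuple.
Qed.

Lemma measurable_subRd f h : measurable_fun setT f -> measurable_fun setT h ->
  measurable_fun setT (fun x => subRd (f x) (h x)).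
Proof.
move=> mf mh; apply/measurable_fun_tnthP => i.
have : measurable_fun setT (fun x => tnth (f x) i - tnth (h x) i).
  by apply: measurable_funB; apply: (measurableT_comp (measurable_tnth i)).
by move/measurable_ext; apply => x /=; rewrite tnth_mktuple.
Qed.

End measurability.

(** Sup-norm balls replace Euclidean ones because their volume is a product of lengths. *)
Definition cube (r : R) : set (Rd R d) := [set k | forall i, `|tnth k i| <= r].

Lemma cube_measure r : 0 <= r ->
  measurable (cube r) /\ leb R d (cube r) = ((2 * r) ^+ d)%:E.
Proof.
move=> r0; have mI : measurable (`[- r, r]%classic : set (measurableTypeR R)).
  exact: measurable_itv.
have [mC leC] := tuple_measure_cube (@lebesgue_measure R) d mI.
have E : cube r = [set t | forall i, `[- r, r]%classic (tnth t i)].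
  by apply/seteqP; split=> k /= h i; have := h i; rewrite ?in_itv/= ler_norml.
rewrite E; split=> //; rewrite /leb leC EFin_expe; congr (_ ^+ d)%E.
apply: (eq_trans (lebesgue_measure_itv `[- r, r])); rewrite /= lte_fin.
have [rr|rr] := ltP (- r) r; first by rewrite -EFinB; congr EFin; ring.
by rewrite (_ : r = 0) ?mulr0//; apply/eqP; rewrite eq_le r0 andbT; lra.
Qed.

(** This replaces polar coordinates. Every nonzero value of [f] is dominated by one term of the
    series of [c j] times the indicator of [cube (r j)]. The cubes may overlap; only a geometric
    bound on the integrals of the terms matters. *)
Lemma integral_dyadic (f : Rd R d -> R) (c r : nat -> R) (A q : R) :
  measurable_fun setT f -> (forall k, 0 <= f k) ->
  (forall j, 0 <= c j) -> (forall j, 0 <= r j) -> 0 <= q < 1 ->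
  (forall k, f k = 0 \/ exists2 j, f k <= c j & cube (r j) k) ->
  (forall j, c j * (2 * r j) ^+ d <= A * q ^+ j) ->
  (\int[leb R d]_k (f k)%:E < +oo)%E.
Proof.
move=> mf f0 c0 r0 q01 fcr cr.
have A0 : 0 <= A.
  have := cr 0%N; rewrite expr0 mulr1; apply: le_trans.
  by rewrite mulr_ge0// exprn_ge0// mulr_ge0.
have mcube j : measurable (cube (r j)) by case: (cube_measure (r0 j)).
pose F (j : nat) k : \bar R := (c j * \1_(cube (r j)) k)%:E.
have F0 j k : (0 <= F j k)%E by rewrite lee_fin mulr_ge0.
have mF j : measurable_fun setT (F j).
  by apply/measurable_EFinP; apply: measurable_funM => //; exact: measurable_indic.
apply: (@le_lt_trans _ _ (A * (1 - q)^-1)%:E); last exact: ltry.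
apply: (@le_trans _ _ (\int[leb R d]_k (\sum_(0 <= j <oo) F j k))%E).
  apply: ge0_le_integral => //.
  - by move=> k _; rewrite lee_fin.
  - exact/measurable_EFinP.
  - exact: ge0_emeasurable_sum.
  move=> k _; have [->|[j fc kj]] := fcr k; first by apply: nneseries_ge0 => j _ _.
  apply: (@le_trans _ _ (F j k)).
    by rewrite /F indicE mem_set// mulr1 lee_fin.
  rewrite (nneseries_split 0 j.+1)// big_nat_recr//=.
  rewrite -[leLHS]adde0; apply: leeD; last by apply: nneseries_ge0 => i _ _.
  rewrite -[leLHS]add0e; apply: leeD => //.
  by apply: sume_ge0 => i _.
rewrite integral_nneseries//.
apply: nneseries_le_bound => [n|n]; first exact: integral_ge0.
apply: (@le_trans _ _ (\sum_(0 <= i < n) (A * q ^+ i)%:E)%E).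
  apply: lee_sum => j _; rewrite /F.
  under eq_integral do rewrite EFinM.
  rewrite ge0_integralZl_EFin//; last by apply/measurable_EFinP; exact: measurable_indic.
  rewrite integral_indic// setIT.
  have [_ leE] := cube_measure (r0 j).
  apply: (@le_trans _ _ ((c j)%:E * leb R d (cube (r j)))%E) => //.
  by rewrite leE -EFinM lee_fin.
rewrite sumEFin lee_fin -mulr_sumr ler_wpM2l//; exact: geometric_sum_le.
Qed.


Lemma cube_sqnorm (r : R) k : 0 <= r -> sqnorm k <= r ^+ 2 -> cube r k.
Proof.
move=> r0 kr i; rewrite -(ler_pXn2r (ltn0Sn 1)) ?nnegrE// real_normK ?num_real//.
exact: le_trans (coord_le_sqnorm _ _) kr.
Qed.

(** On the shell 4^(-j-1) < |k|^2 <= 4^(-j) the power is at most 4^(a(j+1)), and the enclosing cube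
    has side 2 * 2^(-j). The ratio 4^a / 2^d is below 1 because a < d/2. *)
Lemma integral_singular (a : R) : 0 <= a -> a < d%:R / 2 ->
  (\int[leb R d]_k ((sqnorm k <= 1)%R%:R * sqnorm k `^ (- a))%:E < +oo)%E.
Proof.
move=> a0; rewrite ltr_pdivlMr// => ad.
have m : measurable_fun setT (fun k : Rd R d => (sqnorm k <= 1)%R%:R * sqnorm k `^ (- a)).
  apply: measurable_funM.
    by apply/measurable_bool_fun/measurable_fun_ler => //; exact: measurable_sqnorm.
  exact/measurable_powR_fun/measurable_sqnorm.
pose c j : R := (4 ^+ j.+1) `^ a.
pose r j : R := 2 ^- j.
apply: (@integral_dyadic _ c r (4 `^ a * 2 ^+ d) (4 `^ a / 2 ^+ d)) => //.
- by move=> k; rewrite mulr_ge0// powR_ge0.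
- by move=> j; exact: powR_ge0.
- by move=> j; rewrite invr_ge0 exprn_ge0.
- rewrite divr_ge0 ?powR_ge0 ?exprn_ge0//= ltr_pdivrMr ?exprn_gt0// mul1r.
  by rewrite powR4 -powR_mulrn// ltr_powR ?ltr1n// mulrC.
- move=> k; have [k1|k1] := boolP (sqnorm k <= 1); last by left; rewrite mul0r.
  rewrite mul1r; right.
  have [k0|k0] := eqVneq (sqnorm k) 0.
    (* At the origin the power is 1 if [a] is 0 and 0 otherwise, so the outermost shell accommodates
       it. *)
    exists 0%N; last by apply: cube_sqnorm; rewrite /r ?expr0 ?invr1// k0 expr1n.
    apply: (@le_trans _ _ 1).
      rewrite k0; have [->|a1] := eqVneq a 0; first by rewrite oppr0 powRr0.
      by rewrite powR0// oppr_eq0.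
    by rewrite /c expr1 -{1}(powRr0 4); apply: ler_powR => //; rewrite ler1n.
  have kp : 0 < sqnorm k by rewrite lt_neqAle eq_sym k0 sqnorm_ge0.
  have [||j /andP[jl ju]] := @exp_bracket R 4 (sqnorm k)^-1 => //.
    by rewrite invf_ge1.
  exists j.
    rewrite /c -mulN1r powRrM powR_inv1 ?(ltW kp)//; apply: ge0_ler_powR => //.
    - by rewrite nnegrE invr_ge0 ltW.
    - by rewrite nnegrE exprn_ge0.
    - exact: ltW.
  apply: cube_sqnorm; first by rewrite invr_ge0 exprn_ge0.
  rewrite /r exprVn -exprM mulnC exprM -natrX.
  by rewrite -(invrK (sqnorm k)) lef_pV2 ?posrE ?invr_gt0// exprn_gt0.
- move=> j; rewrite /c /r powR_exprn// exprS -!mulrA ler_pM2l ?powR_gt0//.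
  by rewrite !exprMn !exprVn -exprM mulnC exprM mulrCA.
Qed.

(** Same scheme outwards: on 4^j <= 1 + |k|^2 < 4^(j+1) the value is at most 4^(-cj) and the cube
    has side 2 * 2^(j+1), so the ratio is 2^d / 4^c. *)
Lemma integral_decay (c : R) : d%:R / 2 < c ->
  (\int[leb R d]_k ((1 + sqnorm k) `^ (- c))%:E < +oo)%E.
Proof.
rewrite ltr_pdivrMr// => dc.
have c0 : 0 <= c.
  have : 0 <= c * 2 by rewrite (le_trans _ (ltW dc)).
  by rewrite pmulr_lge0.
have m : measurable_fun setT (fun k : Rd R d => (1 + sqnorm k) `^ (- c)).
  by apply/measurable_powR_fun/measurable_funD => //; exact: measurable_sqnorm.
pose c' j : R := (4 ^+ j) `^ (- c).
pose r j : R := 2 ^+ j.+1.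
apply: (@integral_dyadic _ c' r (4 ^+ d) (4 `^ (- c) * 2 ^+ d)) => //.
- by move=> k; rewrite powR_ge0.
- by move=> j; exact: powR_ge0.
- by move=> j; rewrite exprn_ge0.
- rewrite mulr_ge0 ?powR_ge0 ?exprn_ge0//= powRN mulrC ltr_pdivrMr ?powR_gt0//.
  by rewrite mul1r powR4 -powR_mulrn// ltr_powR ?ltr1n// mulrC.
- move=> k; right.
  have k1 : 1 <= 1 + sqnorm k by rewrite lerDl sqnorm_ge0.
  have [//|j /andP[jl ju]] := @exp_bracket R 4 _ _ k1.
  exists j.
    rewrite /c' !powRN lef_pV2 ?posrE ?powR_gt0 ?exprn_gt0//; last first.
      exact: lt_le_trans k1.
    apply: ge0_ler_powR => //; rewrite nnegrE ?exprn_ge0//.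
    exact: le_trans k1.
  apply: cube_sqnorm; first by rewrite exprn_ge0.
  rewrite /r -exprM mulnC exprM -natrX; apply: le_trans (ltW ju).
  by rewrite lerDr.
- move=> j; rewrite /c' /r powR_exprn// [(_ * 2 ^+ d) ^+ j]exprMn.
  have -> : (2 * 2 ^+ j.+1) ^+ d = 2 ^+ d * (2 ^+ d * (2 ^+ d) ^+ j) :> R.
    by rewrite exprMn (exprS _ j) exprMn (exprAC _ j).
  have -> : 4 ^+ d = 2 ^+ d * 2 ^+ d :> R by rewrite -exprMn -natrM.
  by rewrite le_eqVlt; apply/orP; left; apply/eqP; ring.
Qed.

Lemma leb_cball (r : R) : (\int[leb R d]_k ((sqnorm k <= r)%R%:R)%:E < +oo)%E.
Proof.
have m : measurable_fun setT (fun k : Rd R d => (sqnorm k <= r)%R%:R : R).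
  by apply/measurable_bool_fun/measurable_fun_ler => //; exact: measurable_sqnorm.
pose s : R := 1 + `|r|.
have s0 : 0 <= s by rewrite addr_ge0.
have rs : r <= s ^+ 2.
  rewrite /s; have := ler_norm r; have := normr_ge0 r; nra.
have [mC leC] := cube_measure s0.
apply: (@le_lt_trans _ _ (\int[leb R d]_k (\1_(cube s) k)%:E)%E).
  apply: ge0_le_integral => //.
  - exact/measurable_EFinP.
  - by apply/measurable_EFinP; exact: measurable_indic.
  move=> k _; rewrite lee_fin; have [kr|//] := boolP (sqnorm k <= r).
  by rewrite indicE mem_set//; apply: cube_sqnorm => //; exact: le_trans rs.
rewrite integral_indic// setIT; apply: (@le_lt_trans _ _ (leb R d (cube s))) => //.
by rewrite leC ltry.
Qed.

Lemma subRdC k q : sqnorm (subRd q k) = sqnorm (subRd k q).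
Proof.
by rewrite !sqnormE; apply: eq_bigr => i _; rewrite !tnth_mktuple -sqrrN opprB.
Qed.

Lemma integral_shifted_decay (c : R) q :
  (\int[leb R d]_k ((1 + sqnorm (subRd q k)) `^ (- c))%:E =
   \int[leb R d]_k ((1 + sqnorm k) `^ (- c))%:E)%E.
Proof.
pose q' : Rd R d := [tuple - tnth q i | i < d].
pose f k : \bar R := ((1 + sqnorm k) `^ (- c))%:E.
have mf : measurable_fun setT f.
  apply/measurable_EFinP/measurable_powR_fun/measurable_funD => //.
  exact: measurable_sqnorm.
have f0 k : (0 <= f k)%E by rewrite lee_fin powR_ge0.
transitivity (\int[leb R d]_k f (addRd k q'))%E; last exact: leb_preserves_translation.
apply: eq_integral => k _; rewrite subRdC /f; congr (((1 + sqnorm _) `^ _)%:E).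
by apply: eq_from_tnth => i; rewrite !tnth_mktuple.
Qed.

(** The point is uniformity in [q]: after [kernel_pointwise], [q] occurs only in a translate, whose
    integral does not depend on it. *)
Lemma kernel_bound (a b s : R) : 0 <= a -> a < d%:R / 2 -> 0 <= b -> 0 <= s ->
  d%:R / 2 < a + b + s ->
  exists C : R, forall q, (\int[leb R d]_k
    (sqnorm k `^ (- a) * (1 + sqnorm k) `^ (- b) *
     (1 + sqnorm (subRd q k)) `^ (- s))%:E <= C%:E)%E.
Proof.
move=> a0 ad b0 s0 abs.
have I1 := integral_singular a0 ad; have I2 := integral_decay abs.
set J1 := integral _ _ _ in I1; set J2 := integral _ _ _ in I2.
have [J1f J2f] : J1 \is a fin_num /\ J2 \is a fin_num.
  by split; rewrite ge0_fin_numE//; apply: integral_ge0 => k _;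
    rewrite lee_fin ?mulr_ge0// powR_ge0.
exists (fine J1 + 2 `^ a * (fine J2 + fine J2)) => q.
rewrite EFinD EFinM EFinD !fineK//.
pose f1 k : \bar R := ((sqnorm k <= 1)%R%:R * sqnorm k `^ (- a))%:E.
pose f2 k : \bar R := ((1 + sqnorm k) `^ (- (a + b + s)))%:E.
pose f3 k : \bar R := ((1 + sqnorm (subRd q k)) `^ (- (a + b + s)))%:E.
have m0 : measurable_fun setT (@sqnorm R d) by exact: measurable_sqnorm.
have m0q : measurable_fun setT (fun k => sqnorm (subRd q k)).
  by apply: measurable_sqnorm; exact: measurable_subRd.
have m1 : measurable_fun setT f1.
  apply/measurable_EFinP/measurable_funM.
    exact/measurable_bool_fun/measurable_fun_ler.
  exact/measurable_powR_fun.
have m2 : measurable_fun setT f2.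
  exact/measurable_EFinP/measurable_powR_fun/measurable_funD.
have m3 : measurable_fun setT f3.
  exact/measurable_EFinP/measurable_powR_fun/measurable_funD.
have f10 k : (0 <= f1 k)%E by rewrite lee_fin mulr_ge0// powR_ge0.
have f20 k : (0 <= f2 k)%E by rewrite lee_fin powR_ge0.
have f30 k : (0 <= f3 k)%E by rewrite lee_fin powR_ge0.
have EJ3 : (\int[leb R d]_k f3 k = J2)%E := integral_shifted_decay _ q.
rewrite -[X in (_ <= _ + _ * (_ + X))%E]EJ3.
rewrite -(ge0_integral_lin (leb R d) (powR_ge0 2 a) m1 m2 m3 f10 f20 f30).
have mK : measurable_fun setT (fun k => sqnorm k `^ (- a) *
    (1 + sqnorm k) `^ (- b) * (1 + sqnorm (subRd q k)) `^ (- s)).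
  apply: measurable_funM; first apply: measurable_funM.
  - exact: measurable_powR_fun.
  - exact/measurable_powR_fun/measurable_funD.
  - exact/measurable_powR_fun/measurable_funD.
have mF : measurable_fun setT (fun k => f1 k + (2 `^ a)%:E * (f2 k + f3 k))%E.
  by apply: emeasurable_funD m1 _; apply: measurable_funeM; exact: emeasurable_funD m2 m3.
apply: ge0_le_integral.
- exact: measurableT.
- by move=> k _; rewrite lee_fin !mulr_ge0 ?powR_ge0.
- exact/measurable_EFinP.
- exact: mF.
move=> k _; rewrite /f1 /f2 /f3 -[leRHS]/(((sqnorm k <= 1)%R%:R * sqnorm k `^ (- a) +
   2 `^ a * ((1 + sqnorm k) `^ (- (a + b + s)) +
             (1 + sqnorm (subRd q k)) `^ (- (a + b + s))))%:E) lee_fin.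
exact: (kernel_pointwise a0 b0 s0 (sqnorm_ge0 _) (sqnorm_ge0 _)).
Qed.

End Rd_integrals.

(** * Configurations *)

Section configurations.
Variables (R : realType) (d M : nat).
Local Notation Rd := (Rd R d).
Local Notation tmu n := (tuple_measure (leb R d) n).

Lemma measurable_shift e (T : measurableType e) (P : T -> M.-tuple Rd) (k : T -> Rd)
    (i : 'I_M) : measurable_fun setT P -> measurable_fun setT k ->
  measurable_fun setT (fun x => Defs.shift (P x) i (k x)).
Proof.
move=> mP mk; apply/measurable_fun_tnthP => l.
have mPl : measurable_fun setT (fun x => tnth (P x) l).
  exact: measurableT_comp (measurable_tnth l) mP.
have [li|li] := eqVneq l i.
  apply: (measurable_ext (measurable_addRd mPl mk)) => x /=.
  by rewrite tnth_mktuple li eqxx.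
by apply: (measurable_ext mPl) => x /=; rewrite tnth_mktuple (negbTE li).
Qed.

Lemma measurable_removal n (i : 'I_M) (j : 'I_n.+1) :
  measurable_fun setT (fun X : config R d M n.+1 =>
    ((Defs.shift X.1 i (tnth X.2 j), delete X.2 j), tnth X.2 j)).
Proof.
have mk : measurable_fun setT (fun X : config R d M n.+1 => tnth X.2 j).
  exact: measurableT_comp (measurable_tnth j) measurable_snd.
apply: measurable_fun_pair => //=; apply: measurable_fun_pair => /=.
  exact: measurable_shift.
exact: measurableT_comp (@measurable_tuple_delete _ Rd n j) measurable_snd.
Qed.

Lemma integral_removal n (i : 'I_M) (j : 'I_n.+1)
    (f : config R d M n * Rd -> \bar R) :
  measurable_fun setT f -> (forall z, 0 <= f z)%E ->
  (\int[config_measure R d M n.+1]_X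
     f ((Defs.shift X.1 i (tnth X.2 j), delete X.2 j), tnth X.2 j) =
   \int[config_measure R d M n]_Y \int[leb R d]_k f (Y, k))%E.
Proof.
move=> mf f0.
apply: (@integral_shear _ _ _ _ _ _ _ (fun P k => Defs.shift P i k)) => //.
  exact: measurable_shift measurable_fst measurable_snd.
move=> k h mh h0.
(* For fixed [k] the shift translates particle [i] and fixes the others, hence acts
   coordinatewise. *)
pose S (l : 'I_M) (x : Rd) : Rd := if l == i then addRd x k else x.
rewrite -(@integral_tuple_map _ _ _ (leb R d) M S h)//.
  move=> l; rewrite /S; case: eqP => _; last exact: measurable_id.
  exact: (measurable_addRd (@measurable_id _ _ setT) (measurable_cst k)).
by move=> l; rewrite /S; case: eqP => _; [exact: leb_preserves_translation|].
Qed.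

Variable omega : Rd -> R.
Hypothesis momega : measurable_fun setT omega.
Hypothesis omega0 : forall k, 0 <= omega k.

Lemma symbolL_ge0 n (X : config R d M n) : 0 <= symbolL omega X.
Proof. by rewrite addr_ge0// sumr_ge0// => i _; exact: sqnorm_ge0. Qed.

Lemma measurable_symbolL n : measurable_fun setT (@symbolL R d M omega n).
Proof.
apply: measurable_funD; apply: measurable_sum_fun => i.
  by apply: measurable_sqnorm; exact: measurableT_comp (measurable_tnth i) measurable_fst.
apply: (measurableT_comp momega).
exact: measurableT_comp (measurable_tnth i) measurable_snd.
Qed.

Lemma sum_delete n (K : n.+1.-tuple Rd) (j : 'I_n.+1) (h : Rd -> R) :
  \sum_(l < n.+1) h (tnth K l) = h (tnth K j) + \sum_(l < n) h (tnth (delete K j) l).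
Proof.
rewrite (bigD1_ord j)//=; congr (_ + _).
by apply: eq_bigr => l _; rewrite tnth_mktuple.
Qed.

Lemma symbolL_permute n (s : 'S_n) (X : config R d M n) :
  symbolL omega (X.1, permute s X.2) = symbolL omega X.
Proof.
congr (_ + _); rewrite [RHS](reindex_inj (@perm_inj _ s))/=.
by apply: eq_bigr => j _; rewrite tnth_mktuple.
Qed.

End configurations.

(** * Square norms of complex functions and the operator G *)

Section complex_lemmas.
Variable R : realType.
Implicit Types (z w : R[i]) (a : R).

Lemma sqr_normcE z : Normc.normc z ^+ 2 = complex.Re z ^+ 2 + complex.Im z ^+ 2.
Proof. by case: z => x y; rewrite sqr_sqrtr//= addr_ge0 ?sqr_ge0. Qed.

Lemma normc_ge0 z : 0 <= Normc.normc z.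
Proof. by case: z => x y; exact: sqrtr_ge0. Qed.

Lemma normc_real a : Normc.normc a%:C = `|a|.
Proof. by rewrite /= expr0n/= addr0 sqrtr_sqr. Qed.

Lemma sqr_normc_scale a z :
  Normc.normc (a%:C * z) ^+ 2 = a ^+ 2 * Normc.normc z ^+ 2.
Proof. by rewrite Normc.normcM normc_real exprMn real_normK ?num_real. Qed.

Lemma normc_sum (I : Type) (s : seq I) (P : pred I) (x : I -> R[i]) :
  Normc.normc (\sum_(i <- s | P i) x i) <= \sum_(i <- s | P i) Normc.normc (x i).
Proof.
elim/big_rec2: _ => [|i y z _ IH]; first by rewrite Normc.normc0.
by apply: le_trans (le_normcD _ _) _; rewrite lerD2l.
Qed.

Lemma sqr_normcB_le z w :
  Normc.normc z ^+ 2 <= 2 * Normc.normc (z - w) ^+ 2 + 2 * Normc.normc w ^+ 2.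
Proof.
have : Normc.normc z <= Normc.normc (z - w) + Normc.normc w.
  by rewrite -{1}(subrK w z) le_normcD.
set a := Normc.normc z; set b := Normc.normc (z - w); set c := Normc.normc w => abc.
apply: (@le_trans _ _ ((b + c) ^+ 2)).
  by apply: lerXn2r => //; rewrite nnegrE ?addr_ge0 ?normc_ge0.
rewrite -subr_ge0 (_ : _ - _ = (b - c) ^+ 2) ?sqr_ge0//; ring.
Qed.

(** Interpolation between two lower bounds of L. It shares a single factor 1/L between the boson
    number and the kinetic energy of a particle. *)
Lemma invr_le_powR (L a b dl : R) : 0 < a <= L -> 0 < b <= L -> 0 <= dl <= 1 ->
  L^-1 <= a `^ (- dl) * b `^ (- (1 - dl)).
Proof.
move=> /andP[a0 aL] /andP[b0 bL] /andP[dl0 dl1].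
have L0 : 0 < L by exact: lt_le_trans aL.
have dl1' : 0 <= 1 - dl by rewrite subr_ge0.
have -> : L^-1 = L `^ (- dl) * L `^ (- (1 - dl)).
  rewrite -powRD ?(gt_eqF L0) ?implybT// -powR_inv1 ?(ltW L0)//; congr (_ `^ _); ring.
have mono (z e : R) : 0 < z -> z <= L -> 0 <= e -> L `^ (- e) <= z `^ (- e).
  move=> z0 zL e0; rewrite !powRN lef_pV2 ?posrE ?powR_gt0//.
  by apply: ge0_ler_powR => //; rewrite nnegrE ltW.
by apply: ler_pM; rewrite ?powR_ge0// mono.
Qed.

(* Expand 0 <= sum_i (a_i - t w_i)^2 / w_i at t = (sum a) / (sum w). *)
Lemma weighted_cauchy_schwarz (I : finType) (w a : I -> R) :
  (forall i, 0 < w i) ->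
  (\sum_i a i) ^+ 2 <= (\sum_i w i) * \sum_i a i ^+ 2 / w i.
Proof.
move=> w0; set A := \sum_i a i; set W := \sum_i w i; set B := \sum_i _.
have W0 : 0 <= W by apply: sumr_ge0 => i _; exact: ltW.
have [W00|Wn0] := eqVneq W 0.
  have : forall i : I, False.
    move=> i; have := w0 i; rewrite ltNge => /negP; apply.
    by rewrite -W00 /W (bigD1 i)//= lerDl sumr_ge0// => j _; exact: ltW.
  by move=> nI; rewrite /A big1 ?expr0n/= ?W00 ?mul0r// => i _; case: (nI i).
have {Wn0}{}W0 : 0 < W by rewrite lt_neqAle eq_sym Wn0.
pose t := A / W.
have E : \sum_i (a i - t * w i) ^+ 2 / w i = B - 2 * t * A + t ^+ 2 * W.
  rewrite /B /A /W !mulr_sumr -sumrB -big_split/=; apply: eq_bigr => i _.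
  have wi : w i != 0 by rewrite gt_eqF.
  by field.
have : 0 <= B - 2 * t * A + t ^+ 2 * W.
  by rewrite -E sumr_ge0// => i _; rewrite divr_ge0 ?sqr_ge0// ltW.
have -> : B - 2 * t * A + t ^+ 2 * W = (W * B - A ^+ 2) / W.
  by rewrite /t; field; rewrite gt_eqF.
by rewrite pmulr_lge0 ?invr_gt0// subr_ge0.
Qed.

Lemma sqr_normc_sum_le (I : finType) (w : I -> R) (x : I -> R[i]) :
  (forall i, 0 < w i) ->
  Normc.normc (\sum_i x i) ^+ 2 <=
  (\sum_i w i) * \sum_i Normc.normc (x i) ^+ 2 / w i.
Proof.
move=> w0.
have CS := weighted_cauchy_schwarz (fun i => Normc.normc (x i)) w0.
apply: le_trans CS; apply: lerXn2r; rewrite ?nnegrE ?normc_ge0//.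
  by rewrite sumr_ge0// => i _; exact: normc_ge0.
exact: normc_sum.
Qed.

Section cmeasurable.
Context e (T : measurableType e).
Implicit Types f h : T -> R[i].

Lemma cmeasurable_cst z : cmeasurable (fun _ : T => z).
Proof. by split; exact: measurable_cst. Qed.

Lemma cmeasurable_add f h : cmeasurable f -> cmeasurable h ->
  cmeasurable (fun x => f x + h x).
Proof.
move=> [rf mf] [rh mh]; split.
  by apply: (measurable_ext (measurable_funD rf rh)) => x /=; case: (f x) (h x) => ? ? [].
by apply: (measurable_ext (measurable_funD mf mh)) => x /=; case: (f x) (h x) => ? ? [].
Qed.

Lemma cmeasurable_mul f h : cmeasurable f -> cmeasurable h ->
  cmeasurable (fun x => f x * h x).
Proof.
move=> [rf mf] [rh mh]; split.
  apply: (measurable_ext (measurable_funB (measurable_funM rf rh) (measurable_funM mf mh))).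
  by move=> x /=; case: (f x) (h x) => ? ? [].
apply: (measurable_ext (measurable_funD (measurable_funM rf mh) (measurable_funM mf rh))).
by move=> x /=; case: (f x) (h x) => ? ? [].
Qed.

Lemma cmeasurable_real (r : T -> R) : measurable_fun setT r ->
  cmeasurable (fun x => (r x)%:C).
Proof. by move=> mr; split => //=; exact: measurable_cst. Qed.

Lemma cmeasurable_sum (I : Type) (s : seq I) (f : I -> T -> R[i]) :
  (forall i, cmeasurable (f i)) -> cmeasurable (fun x => \sum_(i <- s) f i x).
Proof.
move=> mf; elim: s => [|i s IH].
  by under eq_fun do rewrite big_nil; exact: cmeasurable_cst.
by under eq_fun do rewrite big_cons; exact: cmeasurable_add.
Qed.

Lemma cmeasurable_sub f h : cmeasurable f -> cmeasurable h ->
  cmeasurable (fun x => f x - h x).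
Proof.
move=> mf mh; have := cmeasurable_add mf (cmeasurable_mul (cmeasurable_cst (-1)) mh).
by under eq_fun do rewrite mulN1r.
Qed.

Lemma measurable_sqr_normc f : cmeasurable f ->
  measurable_fun setT (fun x => Normc.normc (f x) ^+ 2).
Proof.
move=> [rf mf].
apply: (measurable_ext (measurable_funD (measurable_funX 2 rf) (measurable_funX 2 mf))).
by move=> x; rewrite sqr_normcE.
Qed.

End cmeasurable.

Lemma cmeasurable_comp e1 e2 (T1 : measurableType e1) (T2 : measurableType e2)
    (f : T2 -> R[i]) (h : T1 -> T2) :
  cmeasurable f -> measurable_fun setT h -> cmeasurable (f \o h).
Proof. by move=> [rf mf] mh; split; [exact: measurableT_comp rf mh|exact: measurableT_comp mf mh]. Qed.

End complex_lemmas.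

(** * Pointwise bounds on G *)

Section creation.
Variables (R : realType) (d M : nat) (g : R).
Variables (vhat : Rd R d -> R[i]) (omega : Rd R d -> R).
Local Notation Rd := (Rd R d).
Local Notation cfg := (config R d M).
Hypothesis mvhat : cmeasurable vhat.
Hypothesis momega : measurable_fun setT omega.
Hypothesis omega1 : forall k, 1 <= omega k.

Let omega0 k : 0 <= omega k. Proof. exact: le_trans (omega1 k). Qed.

Definition removal n (i : 'I_M) (j : 'I_n.+1) (X : cfg n.+1) : cfg n :=
  (Defs.shift X.1 i (tnth X.2 j), delete X.2 j).

Definition creation_term (psi : fock R d M) n (p : 'I_M * 'I_n.+1) (X : cfg n.+1) :
    R[i] :=
  vhat (tnth X.2 p.2) * psi n (removal p.1 p.2 X).

Definition creation_sum psi n (X : cfg n.+1) : R[i] :=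
  \sum_p creation_term psi p X.

Lemma opG_creation psi n (X : cfg n.+1) : opG omega g vhat psi X =
  (- g / Num.sqrt n.+1%:R / symbolL omega X)%:C * creation_sum psi X.
Proof.
rewrite rmorphM fmorphV /= -mulrA; congr (_ * _).
rewrite /creation_sum mulr_sumr (pair_bigA _ (fun i j => _))/=.
by apply: eq_bigr => -[i j] _; rewrite mulrC.
Qed.

Lemma sqr_normc_opG psi n (X : cfg n.+1) :
  Normc.normc (opG omega g vhat psi X) ^+ 2 =
  g ^+ 2 / n.+1%:R / symbolL omega X ^+ 2 * Normc.normc (creation_sum psi X) ^+ 2.
Proof.
rewrite opG_creation sqr_normc_scale; congr (_ * _).
by rewrite !exprMn sqrrN !exprVn sqr_sqrtr.
Qed.

Lemma sqr_normc_creation_term psi n p (X : cfg n.+1) :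
  Normc.normc (creation_term psi p X) ^+ 2 =
  Normc.normc (vhat (tnth X.2 p.2)) ^+ 2 * Normc.normc (psi n (removal p.1 p.2 X)) ^+ 2.
Proof. by rewrite Normc.normcM exprMn. Qed.

Lemma cmeasurable_creation_term (psi : fock R d M) n (p : 'I_M * 'I_n.+1) :
  cmeasurable (psi n) -> cmeasurable (creation_term psi p).
Proof.
move=> mpsi.
have mk : measurable_fun setT (fun X : cfg n.+1 => tnth X.2 p.2).
  exact: measurableT_comp (measurable_tnth p.2) measurable_snd.
have mr : measurable_fun setT (removal p.1 p.2 : cfg n.+1 -> cfg n).
  exact: measurableT_comp measurable_fst (@measurable_removal R d M n p.1 p.2).
exact: cmeasurable_mul (cmeasurable_comp mvhat mk) (cmeasurable_comp mpsi mr).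
Qed.

Lemma cmeasurable_creation_sum psi n :
  cmeasurable (psi n) -> cmeasurable (@creation_sum psi n).
Proof.
by move=> mpsi; apply: cmeasurable_sum => p; exact: cmeasurable_creation_term.
Qed.

Lemma cmeasurable_opGS (psi : fock R d M) n :
  cmeasurable (psi n) -> cmeasurable (opG omega g vhat psi (n := n.+1)).
Proof.
move=> mpsi.
have -> : opG omega g vhat psi (n := n.+1) = fun X =>
    (- g / Num.sqrt n.+1%:R / symbolL omega X)%:C * creation_sum psi X.
  by apply/funext => X; exact: opG_creation.
apply: cmeasurable_mul (cmeasurable_creation_sum mpsi).
apply: cmeasurable_real; apply: measurable_funM; first exact: measurable_cst.
apply: measurable_invr_fun; last exact: measurable_symbolL.
by move=> X; exact: symbolL_ge0.
Qed.

Lemma cmeasurable_opG (psi : fock R d M) n :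
  (forall m, cmeasurable (psi m)) -> cmeasurable (opG omega g vhat psi (n := n)).
Proof.
by move=> mpsi; case: n => [|n]; [exact: cmeasurable_cst|exact: cmeasurable_opGS].
Qed.

Lemma symbolL_ge_card n (X : cfg n) : n%:R <= symbolL omega X.
Proof.
apply: (@le_trans _ _ (\sum_(j < n) omega (tnth X.2 j))).
  rewrite -[leLHS]mulr1 mulr_natl -[n in leLHS]card_ord -sumr_const.
  exact: ler_sum.
by rewrite lerDr sumr_ge0// => i _; exact: sqnorm_ge0.
Qed.

Lemma symbolL_ge1 n (X : cfg n.+1) : 1 <= symbolL omega X.
Proof. by apply: le_trans (symbolL_ge_card X); rewrite ler1n. Qed.

(** The original particle momentum is q_i - k_j in the variables left after removal. This rewriting
    turns lower bounds on L into the kernel of [kernel_bound]. *)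
Lemma sqnorm_removal n (i : 'I_M) (j : 'I_n.+1) (X : cfg n.+1) :
  sqnorm (subRd (tnth (removal i j X).1 i) (tnth X.2 j)) = sqnorm (tnth X.1 i).
Proof.
congr sqnorm; apply: eq_from_tnth => l.
by rewrite !tnth_mktuple eqxx tnth_mktuple addrK.
Qed.

(** The summand 1 is the energy of one boson, present because the sector is [n.+1]. *)
Lemma symbolL_ge_sqnorm n (i : 'I_M) (X : cfg n.+1) :
  1 + sqnorm (tnth X.1 i) <= symbolL omega X.
Proof.
rewrite addrC lerD//.
  by rewrite (bigD1 i)//= lerDl sumr_ge0// => l _; exact: sqnorm_ge0.
rewrite (bigD1 ord0)//=; apply: ler_wpDr => //.
by rewrite sumr_ge0.
Qed.

(** The square of G carries L^(-2). One power of L pays for the Cauchy-Schwarz weights, whose sum is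
    at most M L since each boson is counted once per particle. The other is interpolated by
    [invr_le_powR] between the boson number and 1 + p_i^2. *)
Lemma opG_pointwise psi n (X : cfg n.+1) (dl : R) : 0 <= dl <= 1 ->
  Normc.normc (opG omega g vhat psi X) ^+ 2 <=
  g ^+ 2 * M%:R / n.+1%:R * n.+1%:R `^ (- dl) * \sum_(p : 'I_M * 'I_n.+1)
    (Normc.normc (vhat (tnth X.2 p.2)) ^+ 2 / omega (tnth X.2 p.2) *
     (1 + sqnorm (subRd (tnth (removal p.1 p.2 X).1 p.1) (tnth X.2 p.2))) `^ (- (1 - dl)) *
     Normc.normc (psi n (removal p.1 p.2 X)) ^+ 2).
Proof.
move=> /andP[dl0 dl1]; rewrite sqr_normc_opG; set L := symbolL omega X.
have L0 : 0 < L by apply: lt_le_trans (symbolL_ge1 X).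
pose w (p : 'I_M * 'I_n.+1) := omega (tnth X.2 p.2).
have w0 p : 0 < w p by apply: lt_le_trans (omega1 _).
have sw : \sum_p w p <= M%:R * L.
  rewrite -(pair_bigA _ (fun (i : 'I_M) j => omega (tnth X.2 j)))/=.
  rewrite sumr_const card_ord [leRHS]mulr_natl lerMn2r; apply/orP; right.
  by rewrite lerDr sumr_ge0// => i _; exact: sqnorm_ge0.
set S := \sum_(p : 'I_M * 'I_n.+1) _.
have S1 : (\sum_p Normc.normc (creation_term psi p X) ^+ 2 / w p) / L <=
    n.+1%:R `^ (- dl) * S.
  rewrite mulr_suml mulr_sumr; apply: ler_sum => p _.
  rewrite sqr_normc_creation_term sqnorm_removal.
  set V := Normc.normc (vhat _) ^+ 2; set u := Normc.normc (psi _ _) ^+ 2.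
  have LL : L^-1 <= n.+1%:R `^ (- dl) * (1 + sqnorm (tnth X.1 p.1)) `^ (- (1 - dl)).
    apply: invr_le_powR; last by rewrite dl0.
      by rewrite ltr0Sn symbolL_ge_card.
    by rewrite symbolL_ge_sqnorm andbT ltr_pwDl// sqnorm_ge0.
  have V0 : 0 <= V by exact: sqr_ge0.
  have u0 : 0 <= u by exact: sqr_ge0.
  have Vu : 0 <= V * u / w p.
    by apply: divr_ge0; [exact: mulr_ge0|exact: ltW (w0 p)].
  apply: le_trans (ler_wpM2l Vu LL) _; rewrite /w.
  by rewrite le_eqVlt; apply/orP; left; apply/eqP; set W := (omega _)^-1; ring.
apply: (@le_trans _ _ (g ^+ 2 / n.+1%:R / L ^+ 2 *
    ((M%:R * L) * \sum_p Normc.normc (creation_term psi p X) ^+ 2 / w p))).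
  apply: ler_wpM2l.
    by apply: divr_ge0; [apply: divr_ge0|]; rewrite ?sqr_ge0 ?ler0n.
  apply: le_trans (sqr_normc_sum_le _ w0) _; apply: ler_wpM2r => //.
  by rewrite sumr_ge0// => p _; rewrite divr_ge0 ?sqr_ge0// ltW.
have Ln0 : L != 0 by rewrite gt_eqF.
rewrite (_ : _ * (_ * _) = g ^+ 2 * M%:R / n.+1%:R *
  ((\sum_p Normc.normc (creation_term psi p X) ^+ 2 / w p) / L)); last first.
  have : (n.+1%:R : R) != 0 by rewrite pnatr_eq0.
  by move: (n.+1%:R : R) => N N0; field; rewrite Ln0 N0.
rewrite -[leRHS]mulrA ler_wpM2l//.
by apply: divr_ge0; [apply: mulr_ge0|]; rewrite ?sqr_ge0 ?ler0n.
Qed.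

(** Unit weights in Cauchy-Schwarz cost M (n+1), which cancels the 1/(n+1) of the creation operator.
    With one L multiplied back in, a single 1/L remains, and all of it goes into 1 + p_i^2. *)
Lemma sqrt_opG_pointwise psi n (X : cfg n.+1) :
  symbolL omega X * Normc.normc (opG omega g vhat psi X) ^+ 2 <=
  g ^+ 2 * M%:R * \sum_(p : 'I_M * 'I_n.+1)
    (Normc.normc (vhat (tnth X.2 p.2)) ^+ 2 *
     (1 + sqnorm (subRd (tnth (removal p.1 p.2 X).1 p.1) (tnth X.2 p.2)))^-1 *
     Normc.normc (psi n (removal p.1 p.2 X)) ^+ 2).
Proof.
rewrite sqr_normc_opG; set L := symbolL omega X.
have L0 : 0 < L by apply: lt_le_trans (symbolL_ge1 X).
set S := \sum_(p : 'I_M * 'I_n.+1) _.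
have S1 : (\sum_p Normc.normc (creation_term psi p X) ^+ 2 / 1) / L <= S.
  rewrite mulr_suml; apply: ler_sum => p _.
  rewrite sqr_normc_creation_term sqnorm_removal divr1.
  rewrite [leRHS]mulrAC; apply: ler_wpM2l; first by rewrite mulr_ge0 ?sqr_ge0.
  by rewrite lef_pV2 ?posrE ?symbolL_ge_sqnorm// ltr_pwDl// sqnorm_ge0.
have H : Normc.normc (creation_sum psi X) ^+ 2 <= M%:R * n.+1%:R *
    \sum_p Normc.normc (creation_term psi p X) ^+ 2 / 1.
  have := @sqr_normc_sum_le _ _ (fun _ : 'I_M * 'I_n.+1 => 1) (fun p => creation_term psi p X) (fun _ => ltr01).
  move=> CS; apply: le_trans CS _.
  by rewrite sumr_const card_prod !card_ord natrM.
have Ln0 : L != 0 by rewrite gt_eqF.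
have -> : L * (g ^+ 2 / n.+1%:R / L ^+ 2 * Normc.normc (creation_sum psi X) ^+ 2) =
    g ^+ 2 / n.+1%:R / L * Normc.normc (creation_sum psi X) ^+ 2.
  have : (n.+1%:R : R) != 0 by rewrite pnatr_eq0.
  by move: (n.+1%:R : R) => N N0; field; rewrite Ln0 N0.
apply: le_trans (ler_wpM2l _ H) _.
  by apply: divr_ge0; [apply: divr_ge0|exact: ltW]; rewrite ?sqr_ge0 ?ler0n.
rewrite (_ : _ * (_ * _) = g ^+ 2 * M%:R *
  ((\sum_p Normc.normc (creation_term psi p X) ^+ 2 / 1) / L)); last first.
  have : (n.+1%:R : R) != 0 by rewrite pnatr_eq0.
  by move: (n.+1%:R : R) => N N0; field; rewrite Ln0 N0.
apply: ler_wpM2l => //; apply: mulr_ge0; rewrite ?sqr_ge0 ?ler0n//.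
Qed.

End creation.

(** * Integrated bounds on G *)

Section bounds.
Variables (R : realType) (d M : nat).
Local Notation Rd := (Rd R d).
Local Notation cfg := (config R d M).
Local Notation cmu := (config_measure R d M).

(** A Schur-type estimate: once the change of variables separates [k] from the remaining
    configuration, the kernel need only be integrable in [k] uniformly in the particle momenta. *)
Lemma removal_bound n (i : 'I_M) (j : 'I_n.+1) (kappa : M.-tuple Rd * Rd -> R)
    (u : cfg n -> R) (C : R) :
  measurable_fun setT kappa -> (forall z, 0 <= kappa z) ->
  measurable_fun setT u -> (forall Y, 0 <= u Y) ->
  (forall Q, \int[leb R d]_k (kappa (Q, k))%:E <= C%:E)%E ->
  (\int[cmu n.+1]_X (kappa ((removal i j X).1, tnth X.2 j) * u (removal i j X))%:E
   <= C%:E * \int[cmu n]_Y (u Y)%:E)%E.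
Proof.
move=> mk k0 mu u0 kC.
have C0 : 0 <= C.
  rewrite -lee_fin; apply: le_trans (kC [tuple of nseq M [tuple of nseq d 0]]).
  by apply: integral_ge0 => k _; rewrite lee_fin.
pose f (z : cfg n * Rd) := (kappa (z.1.1, z.2) * u z.1)%:E.
have mf : measurable_fun setT f.
  apply/measurable_EFinP/measurable_funM; last exact: measurableT_comp mu measurable_fst.
  apply: (measurableT_comp mk); apply: measurable_fun_pair => //=.
  exact: measurableT_comp measurable_fst measurable_fst.
have f0 z : (0 <= f z)%E by rewrite lee_fin mulr_ge0.
rewrite [leLHS](integral_removal i j mf f0).
have muE : measurable_fun setT (fun Y : cfg n => (u Y)%:E) by exact/measurable_EFinP.
rewrite -(ge0_integralZl_EFin _ measurableT (fun Y _ => _ : 0 <= (u Y)%:E)%E muE C0);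
  last by move=> Y _; rewrite lee_fin.
apply: ge0_le_integral.
- exact: measurableT.
- by move=> Y _; apply: integral_ge0 => k _; exact: f0.
- exact: (measurable_fun_fubini_tonelli_F (m2 := leb R d) f mf f0).
- exact: measurable_funeM.
move=> Y _.
have mkY : measurable_fun setT (fun k => (kappa (Y.1, k))%:E).
  by apply/measurable_EFinP; exact: measurableT_comp mk (pair1_measurable Y.1).
rewrite (_ : (\int[leb R d]_k f (Y, k) =
    (u Y)%:E * \int[leb R d]_k (kappa (Y.1, k))%:E)%E); last first.
  rewrite -(ge0_integralZl_EFin _ measurableT (fun k _ => _ : 0 <= (kappa (Y.1, k))%:E)%E mkY (u0 Y));
    last by move=> k _; rewrite lee_fin.
  by apply: eq_integral => k _; rewrite /f -EFinM mulrC.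
by rewrite muleC; apply: lee_wpmul2r; [rewrite lee_fin|exact: kC].
Qed.

(** Shared by the two bounds on G and by the remainder in the divergent case; M (n+1) counts the
    terms of the sum. *)
Lemma sum_removal_bound n (kappa : 'I_M -> M.-tuple Rd * Rd -> R)
    (u : cfg n -> R) (F : cfg n.+1 -> R) (A C : R) : 0 <= A -> 0 <= C ->
  (forall i, measurable_fun setT (kappa i)) -> (forall i z, 0 <= kappa i z) ->
  measurable_fun setT u -> (forall Y, 0 <= u Y) ->
  (forall i Q, \int[leb R d]_k (kappa i (Q, k))%:E <= C%:E)%E ->
  measurable_fun setT F -> (forall X, 0 <= F X) ->
  (forall X, F X <= A * \sum_(p : 'I_M * 'I_n.+1)
     (kappa p.1 ((removal p.1 p.2 X).1, tnth X.2 p.2) * u (removal p.1 p.2 X))) ->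
  (\int[cmu n.+1]_X (F X)%:E
   <= (A * ((M * n.+1)%:R * C))%:E * \int[cmu n]_Y (u Y)%:E)%E.
Proof.
move=> A0 C0 mk k0 mu u0 kC mF F0 FA.
have I0 : (0 <= \int[cmu n]_Y (u Y)%:E)%E by apply: integral_ge0 => Y _; rewrite lee_fin.
pose T (p : 'I_M * 'I_n.+1) (X : cfg n.+1) :=
  (kappa p.1 ((removal p.1 p.2 X).1, tnth X.2 p.2) * u (removal p.1 p.2 X))%:E.
have mr p : measurable_fun setT (removal p.1 p.2 : cfg n.+1 -> cfg n).
  exact: measurableT_comp measurable_fst (@measurable_removal R d M n p.1 p.2).
have mT p : measurable_fun setT (T p).
  apply/measurable_EFinP/measurable_funM; last exact: measurableT_comp mu (mr p).
  apply: (measurableT_comp (mk p.1)); apply: measurable_fun_pair => /=.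
    exact: measurableT_comp measurable_fst (mr p).
  exact: measurableT_comp (measurable_tnth p.2) measurable_snd.
have T0 p X : (0 <= T p X)%E by rewrite lee_fin; apply: mulr_ge0.
have mS : measurable_fun setT (fun X => \sum_(p : 'I_M * 'I_n.+1)
    (kappa p.1 ((removal p.1 p.2 X).1, tnth X.2 p.2) * u (removal p.1 p.2 X))).
  by apply: measurable_sum_fun => p; apply/measurable_EFinP; exact: mT.
apply: (@le_trans _ _ (\int[cmu n.+1]_X (A * \sum_(p : 'I_M * 'I_n.+1)
     (kappa p.1 ((removal p.1 p.2 X).1, tnth X.2 p.2) * u (removal p.1 p.2 X)))%:E)%E).
  apply: ge0_le_integral.
  - exact: measurableT.
  - by move=> X _; rewrite lee_fin.
  - exact/measurable_EFinP.
  - by apply/measurable_EFinP; apply: measurable_funM mS; exact: measurable_cst.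
  - by move=> X _; rewrite lee_fin.
have -> : (\int[cmu n.+1]_X (A * \sum_(p : 'I_M * 'I_n.+1)
     (kappa p.1 ((removal p.1 p.2 X).1, tnth X.2 p.2) * u (removal p.1 p.2 X)))%:E =
    A%:E * \sum_p \int[cmu n.+1]_X T p X)%E.
  rewrite -(@ge0_integral_sum _ _ _ (cmu n.+1) setT measurableT _ T mT (fun p X _ => T0 p X)).
  rewrite -(ge0_integralZl_EFin _ measurableT _ _ A0).
  - by apply: eq_integral => X _; rewrite /T sumEFin EFinM.
  - by move=> X _; apply: sume_ge0 => p _; exact: T0.
  - exact: emeasurable_sum.
rewrite EFinM -muleA; apply: lee_wpmul2l; first by rewrite lee_fin.
apply: (@le_trans _ _ (\sum_(p : 'I_M * 'I_n.+1) (C%:E * \int[cmu n]_Y (u Y)%:E))%E).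
  by apply: lee_sum => p _; exact: removal_bound.
rewrite sumr_const card_prod !card_ord EFinM -muleA -[leLHS]mule_natl.
exact: lexx.
Qed.

End bounds.

Section condition_bounds.
Variables (R : realType) (d M : nat) (g : R).
Variables (vhat : Rd R d -> R[i]) (omega : Rd R d -> R) (alpha beta : R).
Local Notation Rd := (Rd R d).
Local Notation cfg := (config R d M).
Local Notation cmu := (config_measure R d M).
Hypothesis mvhat : cmeasurable vhat.
Hypothesis momega : measurable_fun setT omega.
Hypothesis vhat_le : {ae leb R d, forall k,
  Normc.normc (vhat k) <= Num.sqrt (sqnorm k) `^ (- alpha)}.
Hypothesis omega_ge : forall k, (1 + sqnorm k) `^ (beta / 2) <= omega k.
Hypothesis alpha0 : 0 <= alpha.
Hypothesis alphad : alpha < d%:R / 2.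
Hypothesis beta0 : 0 <= beta.

Let V k := Normc.normc (vhat k) ^+ 2.

Let mV : measurable_fun setT V. Proof. exact: measurable_sqr_normc. Qed.

Let V0 k : 0 <= V k. Proof. exact: sqr_ge0. Qed.

Lemma omega_ge1 k : 1 <= omega k.
Proof.
apply: le_trans (omega_ge k); rewrite -[leLHS](powRr0 (1 + sqnorm k)).
apply: ler_powR; last exact: divr_ge0.
by rewrite lerDl sqnorm_ge0.
Qed.

Let measurable_recoil (i : 'I_M) : measurable_fun setT
  (fun z : M.-tuple Rd * Rd => 1 + sqnorm (subRd (tnth z.1 i) z.2)).
Proof.
apply: measurable_funD; first exact: measurable_cst.
apply/measurable_sqnorm/measurable_subRd; last exact: measurable_snd.
exact: measurableT_comp (measurable_tnth i) measurable_fst.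
Qed.

Lemma sqr_vhat_le : {ae leb R d, forall k, V k <= sqnorm k `^ (- alpha)}.
Proof.
apply: filterS vhat_le => k vk.
have -> : sqnorm k `^ (- alpha) = (Num.sqrt (sqnorm k) `^ (- alpha)) ^+ 2.
  rewrite -powR12_sqrt ?sqnorm_ge0// -powR_mulrn ?powR_ge0// -!powRrM.
  by congr (_ `^ _); field.
by apply: lerXn2r => //; rewrite nnegrE ?powR_ge0// normc_ge0.
Qed.

(** One kernel estimate for both bounds on G: [h] is 1/omega with b = beta/2 for G itself, and the
    constant 1 with b = 0 for L^(1/2) G. *)
Lemma vhat_kernel (h : Rd -> R) (b s : R) : 0 <= b -> 0 <= s ->
  d%:R / 2 < alpha + b + s -> measurable_fun setT h ->
  (forall k, 0 <= h k <= (1 + sqnorm k) `^ (- b)) ->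
  exists2 C : R, 0 <= C & forall q, (\int[leb R d]_k
    (V k * h k * (1 + sqnorm (subRd q k)) `^ (- s))%:E <= C%:E)%E.
Proof.
move=> b0 s0 abs mh hb.
have [C hC] := kernel_bound alpha0 alphad b0 s0 abs.
have C0 : 0 <= C.
  rewrite -lee_fin; apply: le_trans (hC [tuple of nseq d 0]).
  by apply: integral_ge0 => k _; rewrite lee_fin !mulr_ge0 ?powR_ge0.
exists C => // q; apply: le_trans (hC q).
have ms : measurable_fun setT (fun k => (1 + sqnorm (subRd q k)) `^ (- s)).
  apply/measurable_powR_fun/measurable_funD; first exact: measurable_cst.
  exact: measurable_sqnorm (measurable_subRd (measurable_cst q) (@measurable_id _ _ setT)).
have m0 : measurable_fun setT (@sqnorm R d) by exact: measurable_sqnorm.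
have h0 k : 0 <= h k by case/andP: (hb k).
apply: ae_ge0_le_integral.
- exact: measurableT.
- move=> k _; rewrite lee_fin; apply: mulr_ge0; last exact: powR_ge0.
  by apply: mulr_ge0; [exact: V0|exact: h0].
- by apply/measurable_EFinP; apply: measurable_funM ms; exact: measurable_funM mV mh.
- by move=> k _; rewrite lee_fin !mulr_ge0 ?powR_ge0.
- apply/measurable_EFinP; apply: measurable_funM ms; apply: measurable_funM.
    exact: measurable_powR_fun.
  by apply/measurable_powR_fun/measurable_funD => //; exact: measurable_cst.
apply: filterS sqr_vhat_le => k Vk _; rewrite lee_fin.
apply: ler_wpM2r; first exact: powR_ge0.
by apply: ler_pM => //; case/andP: (hb k).
Qed.

Lemma opG_bound : d%:R / 2 < alpha + beta / 2 + 1 ->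
  exists C dl : R, [/\ 0 <= C, 0 < dl & forall (psi : fock R d M) n,
    (forall m, cmeasurable (psi m)) ->
    (sqnormL2 (cmu n.+1) (opG omega g vhat psi (n := n.+1)) <=
     (C * n.+1%:R `^ (- dl))%:E * sqnormL2 (cmu n) (psi n))%E].
Proof.
move=> gap; pose e := alpha + beta / 2 + 1 - d%:R / 2.
have e0 : 0 < e by rewrite subr_gt0.
(* Half of the excess [e] keeps the exponent alpha + beta/2 + 1 - dl above d/2; the cap 1 keeps the
   exponent 1 - dl nonnegative. *)
pose dl := Num.min 1 (e / 2).
have dl0 : 0 < dl by rewrite lt_min ltr01 divr_gt0.
have dl1 : dl <= 1 by rewrite ge_min lexx.
have dle : dl < e by rewrite gt_min; apply/orP; right; lra.
have b0 : 0 <= beta / 2 by exact: divr_ge0.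
have [||||C C0 hC] := @vhat_kernel (fun k => (omega k)^-1) (beta / 2) (1 - dl) b0.
- by rewrite subr_ge0.
- by move: dle; rewrite /e; lra.
- by apply: measurable_invr_fun => // k; exact: le_trans (omega_ge1 k).
- move=> k; rewrite invr_ge0 (le_trans ler01 (omega_ge1 k))/= powRN.
  rewrite lef_pV2 ?posrE ?omega_ge ?powR_gt0//.
    exact: lt_le_trans (omega_ge1 k).
  by rewrite ltr_pwDl// sqnorm_ge0.
exists (g ^+ 2 * M%:R * M%:R * C), dl; split=> //.
  by do 3![apply: mulr_ge0 => //]; exact: sqr_ge0.
move=> psi n mpsi.
pose kappa (i : 'I_M) (z : M.-tuple Rd * Rd) :=
  V z.2 / omega z.2 * (1 + sqnorm (subRd (tnth z.1 i) z.2)) `^ (- (1 - dl)).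
pose u Y := Normc.normc (psi n Y) ^+ 2.
pose A := g ^+ 2 * M%:R / n.+1%:R * n.+1%:R `^ (- dl).
have A0 : 0 <= A.
  apply: mulr_ge0; last exact: powR_ge0.
  by apply: divr_ge0 => //; apply: mulr_ge0 => //; exact: sqr_ge0.
have om0 k : 0 <= omega k by exact: le_trans (omega_ge1 k).
have mk i : measurable_fun setT (kappa i).
  apply: measurable_funM.
    apply: measurable_funM; first exact: measurableT_comp mV measurable_snd.
    apply: measurable_invr_fun => [z|]; first exact: om0.
    exact: measurableT_comp momega measurable_snd.
  exact: measurable_powR_fun (measurable_recoil i).
have k0 i z : 0 <= kappa i z.
  by apply: mulr_ge0; [apply: divr_ge0|exact: powR_ge0].
have mu : measurable_fun setT u by exact: measurable_sqr_normc.
have u0 Y : 0 <= u Y by exact: sqr_ge0.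
have mF : measurable_fun setT (fun X : cfg n.+1 =>
    Normc.normc (opG omega g vhat psi X) ^+ 2).
  apply: measurable_sqr_normc; apply: cmeasurable_opG => //.
  exact: omega_ge1.
have := sum_removal_bound A0 C0 mk k0 mu u0 (fun i Q => hC (tnth Q i)) mF
  (fun X => sqr_ge0 _) (fun X => opG_pointwise g vhat omega_ge1 psi X _).
set D := (A * _)%R => H.
have -> : g ^+ 2 * M%:R * M%:R * C * n.+1%:R `^ (- dl) = D.
  rewrite /D /A natrM; have : (n.+1%:R : R) != 0 by rewrite pnatr_eq0.
  by move: (n.+1%:R : R) (n.+1%:R `^ (- dl)) => N P N0; field.
by apply: H; rewrite dl1 ltW.
Qed.

Lemma sqrt_opG_bound : d%:R / 2 < alpha + 1 ->
  exists2 C : R, 0 <= C & forall (psi : fock R d M) n,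
    (forall m, cmeasurable (psi m)) ->
    (\int[cmu n.+1]_X (symbolL omega X *
       Normc.normc (opG omega g vhat psi X) ^+ 2)%:E <=
     (C * n.+1%:R)%:E * sqnormL2 (cmu n) (psi n))%E.
Proof.
move=> gap.
have [|||C C0 hC] := @vhat_kernel (fun=> 1) 0 1 (lexx 0) ler01.
- by rewrite addr0.
- exact: measurable_cst.
- by move=> k; rewrite oppr0 powRr0 ler01 lexx.
exists (g ^+ 2 * M%:R * M%:R * C).
  by do 3![apply: mulr_ge0 => //]; exact: sqr_ge0.
move=> psi n mpsi.
pose kappa (i : 'I_M) (z : M.-tuple Rd * Rd) :=
  V z.2 * (1 + sqnorm (subRd (tnth z.1 i) z.2))^-1.
pose u Y := Normc.normc (psi n Y) ^+ 2.
pose A := g ^+ 2 * M%:R.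
have A0 : 0 <= A by apply: mulr_ge0 => //; exact: sqr_ge0.
have r0 (q k : Rd) : 0 <= 1 + sqnorm (subRd q k) by rewrite addr_ge0// sqnorm_ge0.
have mk i : measurable_fun setT (kappa i).
  apply: measurable_funM; first exact: measurableT_comp mV measurable_snd.
  by apply: measurable_invr_fun => [z|]; [exact: r0|exact: measurable_recoil].
have k0 i z : 0 <= kappa i z by apply: divr_ge0; [exact: V0|exact: r0].
have mu : measurable_fun setT u by exact: measurable_sqr_normc.
have u0 Y : 0 <= u Y by exact: sqr_ge0.
have kC i Q : (\int[leb R d]_k (kappa i (Q, k))%:E <= C%:E)%E.
  apply: le_trans (hC (tnth Q i)); rewrite le_eqVlt; apply/orP; left; apply/eqP.
  by apply: eq_integral => k _; rewrite /kappa mulr1 powR_inv1.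
have mF : measurable_fun setT (fun X : cfg n.+1 => symbolL omega X *
    Normc.normc (opG omega g vhat psi X) ^+ 2).
  apply: measurable_funM; first exact: measurable_symbolL.
  apply: measurable_sqr_normc; apply: cmeasurable_opG => //.
  exact: omega_ge1.
have om0 k : 0 <= omega k by exact: le_trans (omega_ge1 k).
have F0 (X : cfg n.+1) : 0 <= symbolL omega X *
    Normc.normc (opG omega g vhat psi X) ^+ 2.
  by apply: mulr_ge0; [exact: symbolL_ge0|exact: sqr_ge0].
have := sum_removal_bound A0 C0 mk k0 mu u0 kC mF F0
  (fun X => sqrt_opG_pointwise g vhat omega_ge1 psi X).
set D := (A * _)%R => H.
have -> : g ^+ 2 * M%:R * M%:R * C * n.+1%:R = D by rewrite /D /A natrM; ring.
exact: H.
Qed.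

End condition_bounds.

(** * Divergent form integral *)

Section vanishing.
Variables (R : realType) (d M : nat) (g : R).
Variables (vhat : Rd R d -> R[i]) (omega : Rd R d -> R) (alpha : R).
Local Notation Rd := (Rd R d).
Local Notation cfg := (config R d M).
Local Notation cmu := (config_measure R d M).
Hypothesis g_neq0 : g != 0.
Hypothesis mvhat : cmeasurable vhat.
Hypothesis momega : measurable_fun setT omega.
Hypothesis vhat_le : {ae leb R d, forall k,
  Normc.normc (vhat k) <= Num.sqrt (sqnorm k) `^ (- alpha)}.
Hypothesis omega1 : forall k, 1 <= omega k.
Hypothesis alpha0 : 0 <= alpha.
Hypothesis alphad : alpha < d%:R / 2.

Let V k := Normc.normc (vhat k) ^+ 2.

Let mV : measurable_fun setT V. Proof. exact: measurable_sqr_normc. Qed.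

Let V0 k : 0 <= V k. Proof. exact: sqr_ge0. Qed.

Let ms : measurable_fun setT (@sqnorm R d).
Proof. exact: measurable_sqnorm (@measurable_id _ _ setT). Qed.

Let omega0 k : 0 <= omega k. Proof. exact: le_trans (omega1 k). Qed.

Let dispersion k := sqnorm k + omega k.

Let mdispersion : measurable_fun setT dispersion.
Proof. exact: measurable_funD ms momega. Qed.

Let dispersion1 k : 1 <= dispersion k.
Proof. by apply: le_trans (omega1 k) _; rewrite lerDr sqnorm_ge0. Qed.

Let dispersion0 k : 0 <= dispersion k.
Proof. exact: le_trans (dispersion1 k). Qed.

(* Cutting off at [weight <= r] bounds all momenta and all boson energies at once. *)
Let weight n (Y : cfg n) := symbolL dispersion Y.

Let mweight n : measurable_fun setT (@weight n).
Proof. exact: measurable_symbolL. Qed.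

Lemma sqnorm_addRd_le (x k : Rd) : sqnorm x <= 2 * sqnorm (addRd x k) + 2 * sqnorm k.
Proof.
rewrite !sqnormE !mulr_sumr -big_split/=; apply: ler_sum => i _.
rewrite tnth_mktuple -subr_ge0.
rewrite (_ : _ - _ = (tnth x i + 2 * tnth k i) ^+ 2) ?sqr_ge0//; ring.
Qed.

(** Recovering p_i = q_i - k costs 2 q_i^2 + 2 k^2, and everything else in L is bounded by the
    cutoff [r], hence by [r] times the dispersion, which is at least 1. This upper bound on L makes
    the form integrand a lower bound for the main term. *)
Lemma symbolL_removal_le n (i : 'I_M) (j : 'I_n.+1) (X : cfg n.+1) (r : R) :
  weight (removal i j X) <= r ->
  symbolL omega X <= (2 * r + 2) * dispersion (tnth X.2 j).
Proof.
set k := tnth X.2 j => hr.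
pose Q := (removal i j X).1; pose K := (removal i j X).2.
have r0 : 0 <= r by apply: le_trans hr; exact: symbolL_ge0.
have hrE : weight (removal i j X) =
    \sum_(l < M) sqnorm (tnth Q l) + \sum_(l < n) dispersion (tnth K l) by [].
have SK : \sum_(l < n) omega (tnth K l) <= \sum_(l < n) dispersion (tnth K l).
  by apply: ler_sum => l _; rewrite lerDr sqnorm_ge0.
have SK0 : 0 <= \sum_(l < n) dispersion (tnth K l) by rewrite sumr_ge0.
have SP : \sum_(l < M) sqnorm (tnth X.1 l) <=
    2 * \sum_(l < M) sqnorm (tnth Q l) + 2 * sqnorm k.
  rewrite (bigD1 i)//= [in leRHS](bigD1 i)//= mulrDr.
  have h1 := sqnorm_addRd_le (tnth X.1 i) k.
  have E1 : tnth Q i = addRd (tnth X.1 i) k by rewrite tnth_mktuple eqxx.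
  have E2 : \sum_(l < M | l != i) sqnorm (tnth Q l) = \sum_(l < M | l != i) sqnorm (tnth X.1 l).
    by apply: eq_bigr => l li; rewrite tnth_mktuple (negbTE li).
  have S0 : 0 <= \sum_(l < M | l != i) sqnorm (tnth X.1 l).
    by apply: sumr_ge0 => l _; exact: sqnorm_ge0.
  by rewrite E1 E2; lra.
have -> : symbolL omega X = \sum_(l < M) sqnorm (tnth X.1 l) +
    (omega k + \sum_(l < n) omega (tnth K l)) by rewrite -(sum_delete X.2 j omega).
have om := omega0 k; have d1 := dispersion1 k; have s0 := sqnorm_ge0 k.
have dE : dispersion k = sqnorm k + omega k by [].
have : r <= r * dispersion k by rewrite ler_peMr.
move: hr; rewrite hrE mulrDl => hr rr.
by rewrite dE in d1 rr *; lra.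
Qed.

(** The two summands match the two kinds of competing terms: a boson that stays in the bounded
    configuration has its momentum in a ball about 0, and a boson absorbed by another particle has
    it in a ball about -q. Near 0 the bound |k|^(-2 alpha) is integrable; for |k| >= 1 it is at most
    1. *)
Lemma integral_vhat_ball r : exists2 C : R, 0 <= C & forall q : Rd,
  (\int[leb R d]_k ((sqnorm k <= r)%R%:R * V k +
     (1 <= sqnorm k)%R%:R * (sqnorm (addRd k q) <= r)%R%:R * V k)%:E <= C%:E)%E.
Proof.
have I1 := integral_singular alpha0 alphad; have I2 := @leb_cball R d r.
pose f1 (k : Rd) : \bar R := ((sqnorm k <= 1)%R%:R * sqnorm k `^ (- alpha))%:E.
pose f2 (k : Rd) : \bar R := ((sqnorm k <= r)%R%:R)%:E.
pose f3 (q k : Rd) : \bar R := ((sqnorm (addRd k q) <= r)%R%:R)%:E.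
have mb (f : Rd -> R) a : measurable_fun setT f ->
    measurable_fun setT (fun k => (f k <= a)%R%:R : R).
  by move=> mf; apply/measurable_bool_fun/measurable_fun_ler => //; exact: measurable_cst.
have msq q : measurable_fun setT (fun k : Rd => sqnorm (addRd k q)).
  exact: measurable_sqnorm (measurable_addRd (@measurable_id _ _ setT) (measurable_cst q)).
have m1 : measurable_fun setT f1.
  apply/measurable_EFinP; apply: measurable_funM; [exact: mb|exact: measurable_powR_fun].
have m2 : measurable_fun setT f2 by apply/measurable_EFinP; exact: mb.
have m3 q : measurable_fun setT (f3 q) by apply/measurable_EFinP; apply: mb.
have f10 k : (0 <= f1 k)%E by rewrite lee_fin mulr_ge0// powR_ge0.
have f20 k : (0 <= f2 k)%E by rewrite lee_fin.
have f30 q k : (0 <= f3 q k)%E by rewrite lee_fin.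
set J1 := integral _ _ _ in I1; set J2 := integral _ _ _ in I2.
have J10 : (0 <= J1)%E by apply: integral_ge0 => k _; exact: f10.
have J20 : (0 <= J2)%E by apply: integral_ge0 => k _; exact: f20.
have J3 q : (\int[leb R d]_k f3 q k = J2)%E.
  exact: (leb_preserves_translation q m2 f20).
have J1f : J1 \is a fin_num by rewrite ge0_fin_numE.
have J2f : J2 \is a fin_num by rewrite ge0_fin_numE.
exists (fine J1 + 1 * (fine J2 + fine J2)).
  by rewrite mul1r !addr_ge0 ?fine_ge0.
move=> q; rewrite EFinD EFinM EFinD !fineK// -[X in (_ <= _ + _ * (_ + X))%E](J3 q).
rewrite -(ge0_integral_lin (leb R d) ler01 m1 m2 (m3 q) f10 f20 (f30 q)).
apply: ae_ge0_le_integral.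
- exact: measurableT.
- move=> k _; rewrite lee_fin; apply: addr_ge0; apply: mulr_ge0 => //.
- apply/measurable_EFinP; apply: measurable_funD; apply: measurable_funM mV.
    exact: mb.
  apply: measurable_funM; last by apply: mb.
  by apply/measurable_bool_fun/measurable_fun_ler => //; exact: measurable_cst.
- by move=> k _; rewrite mul1e; apply: adde_ge0 => //; apply: adde_ge0.
- apply: emeasurable_funD m1 _; apply: measurable_funeM.
  exact: emeasurable_funD m2 (m3 q).
apply: filterS (sqr_vhat_le vhat_le) => k Vk _.
rewrite /f1 /f2 /f3 -[leRHS]/(((sqnorm k <= 1)%R%:R * sqnorm k `^ (- alpha) +
  1 * ((sqnorm k <= r)%R%:R + (sqnorm (addRd k q) <= r)%R%:R))%:E) lee_fin mul1r addrA.
have Vk1 : 1 <= sqnorm k -> V k <= 1.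
  move=> k1; apply: le_trans Vk _; exact: powR_opp_le1.
have p0 := powR_ge0 (sqnorm k) (- alpha).
have Vk0 := V0 k.
apply: lerD.
  have [kr|kr] := boolP (sqnorm k <= r); last by rewrite mul0r addr0 mulr_ge0.
  rewrite mul1r; have [k1|k1] := boolP (sqnorm k <= 1); first by rewrite mul1r ler_wpDr.
  by rewrite mul0r add0r Vk1// ltW// ltNge.
have [k1|k1] := boolP (1 <= sqnorm k); last by rewrite !mul0r.
rewrite mul1r; case: (sqnorm (addRd k q) <= r); rewrite ?mul0r// mul1r.
exact: Vk1.
Qed.

(** The divergence sits at infinity: on the unit ball the dispersion is at least 1 and the square of
    [vhat] is integrable. *)
Lemma form_integral_tail : form_integral vhat omega = +oo%E ->
  (\int[leb R d]_k ((1 <= sqnorm k)%R%:R * V k / dispersion k)%:E = +oo)%E.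
Proof.
move=> foo; have [C C0 hC] := integral_vhat_ball 1.
have mb : measurable_fun setT (fun k : Rd => (1 <= sqnorm k)%R%:R : R).
  by apply/measurable_bool_fun/measurable_fun_ler => //; exact: measurable_cst.
have mi : measurable_fun setT (fun k => (dispersion k)^-1).
  exact: measurable_invr_fun.
have mt : measurable_fun setT (fun k => (1 <= sqnorm k)%R%:R * V k / dispersion k).
  exact: measurable_funM (measurable_funM mb mV) mi.
have t0 k : 0 <= (1 <= sqnorm k)%R%:R * V k / dispersion k.
  by apply: divr_ge0 => //; exact: mulr_ge0.
pose q0 : Rd := [tuple of nseq d 0].
pose f2 k := (sqnorm k <= 1)%R%:R * V k +
     (1 <= sqnorm k)%R%:R * (sqnorm (addRd k q0) <= 1)%R%:R * V k.
have f20 k : 0 <= f2 k by apply: addr_ge0; apply: mulr_ge0.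
have mf2 : measurable_fun setT f2.
  have mb' (f : Rd -> R) : measurable_fun setT f ->
      measurable_fun setT (fun k => (f k <= 1)%R%:R : R).
    by move=> mf; apply/measurable_bool_fun/measurable_fun_ler => //; exact: measurable_cst.
  apply: measurable_funD; apply: measurable_funM mV; first exact: mb'.
  apply: measurable_funM mb _; apply: mb'.
  exact: measurable_sqnorm (measurable_addRd (@measurable_id _ _ setT) (measurable_cst q0)).
have le2 : (\int[leb R d]_k (V k / dispersion k)%:E <=
    \int[leb R d]_k (((1 <= sqnorm k)%R%:R * V k / dispersion k)%:E + (f2 k)%:E))%E.
  apply: ge0_le_integral.
  - exact: measurableT.
  - by move=> k _; rewrite lee_fin divr_ge0.
  - by apply/measurable_EFinP; exact: measurable_funM mV mi.
  - by apply: emeasurable_funD; apply/measurable_EFinP.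
  move=> k _; rewrite -EFinD lee_fin.
  have [k1|k1] := boolP (1 <= sqnorm k); first by rewrite mul1r ler_wpDr.
  have ks : sqnorm k <= 1 by rewrite ltW// ltNge.
  rewrite mul0r mul0r add0r /f2 (negbTE k1) ks !mul0r addr0 mul1r.
  rewrite ler_pdivrMr ?(lt_le_trans _ (dispersion1 k))//.
  by rewrite ler_peMr.
move: le2; rewrite -[X in (X <= _)%E]/(form_integral vhat omega) foo leye_eq.
rewrite ge0_integralD; [|exact: measurableT|by move=> k _; rewrite lee_fin
  |exact/measurable_EFinP|by move=> k _; rewrite lee_fin|exact/measurable_EFinP].
have := hC q0; rewrite -/f2.
set J2 := (integral _ _ (fun k => (f2 k)%:E)) => J2C /eqP.
set T := integral _ _ _; rewrite -/T; move: J2C.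
by case: J2 => [y| |]//; case: T => [x| |].
Qed.

(** The product of [tail] in the absorbed momentum and [wu] in the remaining configuration is
    dominated by integrable functions. Its integral factors as +oo times the integral of [wu], which
    must therefore be 0. *)
Lemma sector_vanishes (psi : fock R d M) n (i0 : 'I_M) :
  form_integral vhat omega = +oo%E ->
  (forall m, cmeasurable (psi m)) ->
  (sqnormL2 (cmu n) (psi n) < +oo)%E ->
  (\int[cmu n.+1]_X (symbolL omega X *
     Normc.normc (opG omega g vhat psi X) ^+ 2)%:E < +oo)%E ->
  {ae cmu n, forall Y, psi n Y = 0}.
Proof.
move=> foo mpsi psi2 LG2.
pose u (Y : cfg n) := Normc.normc (psi n Y) ^+ 2.
have mu : measurable_fun setT u by exact: measurable_sqr_normc.
have u0 Y : 0 <= u Y by exact: sqr_ge0.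
pose j0 : 'I_n.+1 := ord0; pose p0 := (i0, j0).
pose LG (X : cfg n.+1) := symbolL omega X * Normc.normc (opG omega g vhat psi X) ^+ 2.
have L0 (X : cfg n.+1) : 0 < symbolL omega X.
  by apply: lt_le_trans (symbolL_ge1 omega1 X).
have mLG : measurable_fun setT LG.
  apply: measurable_funM; first exact: measurable_symbolL.
  by apply: measurable_sqr_normc; exact: cmeasurable_opG.
have LG0 X : 0 <= LG X by apply: mulr_ge0; [exact: ltW|exact: sqr_ge0].
(* Countably many integer cutoffs exhaust all configurations. *)
suff ball0 (r : R) : {ae cmu n, forall Y, (weight Y <= r)%R%:R * u Y = 0}.
  have := @ae_foralln _ _ _ (cmu n) (fun (m : nat) Y => (weight Y <= m%:R)%R%:R * u Y = 0)
    (fun m => ball0 m%:R).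
  apply: filterS => Y uY0.
  have := uY0 (Num.bound (weight Y)).
  have -> : weight Y <= (Num.bound (weight Y))%:R.
    by apply/ltW/archi_boundP; exact: symbolL_ge0.
  by rewrite mul1r => /eqP; rewrite sqrf_eq0 => /eqP /Normc.eq0_normc.
pose chi (X : cfg n.+1) : R :=
  (1 <= sqnorm (tnth X.2 j0))%R%:R * (weight (removal i0 j0 X) <= r)%R%:R.
have mr i j : measurable_fun setT (removal i j : cfg n.+1 -> cfg n).
  exact: measurableT_comp measurable_fst (@measurable_removal R d M n i j).
have mk (j : 'I_n.+1) : measurable_fun setT (fun X : cfg n.+1 => tnth X.2 j).
  exact: measurableT_comp (measurable_tnth j) measurable_snd.
have mchi : measurable_fun setT chi.
  apply: measurable_funM; apply/measurable_bool_fun/measurable_fun_ler;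
    try exact: measurable_cst.
    exact: measurable_sqnorm (mk j0).
  exact: measurableT_comp (@mweight n) (mr i0 j0).
have chi01 X : chi X = 0 \/ [/\ chi X = 1, 1 <= sqnorm (tnth X.2 j0) &
    weight (removal i0 j0 X) <= r].
  rewrite /chi; case: (leP 1 (sqnorm _)) => h1; last by left; rewrite mul0r.
  by case: (leP (weight _) r) => h2; [right; rewrite mulr1|left; rewrite mulr0].
pose rest (X : cfg n.+1) := \sum_(p | p != p0)
  chi X * Normc.normc (creation_term vhat psi p X) ^+ 2.
have mrest : measurable_fun setT rest.
  apply: measurable_sum_fun => p; apply: measurable_funM mchi _.
  by apply: measurable_sqr_normc; exact: cmeasurable_creation_term.
have chi0 X : 0 <= chi X by apply: mulr_ge0.
have rest0 X : 0 <= rest X.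
  by apply: sumr_ge0 => p _; apply: mulr_ge0 => //; exact: sqr_ge0.
have rest_fin : (\int[cmu n.+1]_X (rest X)%:E < +oo)%E.
  have [C C0 hC] := integral_vhat_ball r.
  pose kappa (i : 'I_M) (z : M.-tuple Rd * Rd) := (sqnorm z.2 <= r)%R%:R * V z.2 +
    (1 <= sqnorm z.2)%R%:R * (sqnorm (addRd z.2 (tnth z.1 i0)) <= r)%R%:R * V z.2.
  have mkap i : measurable_fun setT (kappa i).
    have mq : measurable_fun setT (fun z : M.-tuple Rd * Rd => tnth z.1 i0).
      exact: measurableT_comp (measurable_tnth i0) measurable_fst.
    have mV2 : measurable_fun setT (fun z : M.-tuple Rd * Rd => V z.2).
      exact: measurableT_comp mV measurable_snd.
    have ms2 : measurable_fun setT (fun z : M.-tuple Rd * Rd => sqnorm z.2).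
      exact: measurable_sqnorm measurable_snd.
    apply: measurable_funD; apply: measurable_funM mV2; [|apply: measurable_funM];
      apply/measurable_bool_fun/measurable_fun_ler => //; try exact: measurable_cst.
    exact: measurable_sqnorm (measurable_addRd measurable_snd mq).
  have kap0 i z : 0 <= kappa i z.
    by apply: addr_ge0; apply: mulr_ge0 => //; exact: V0.
  have restle X : rest X <= 1 * \sum_(p : 'I_M * 'I_n.+1)
     (kappa p.1 ((removal p.1 p.2 X).1, tnth X.2 p.2) * u (removal p.1 p.2 X)).
    rewrite mul1r /rest [leLHS]big_mkcond/=; apply: ler_sum => -[i j] _.
    have T0 : 0 <= kappa i ((removal i j X).1, tnth X.2 j) * u (removal i j X).
      exact: mulr_ge0.
    case: ifP => // pn; have [->|[-> k1 wr]] := chi01 X; first by rewrite mul0r.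
    rewrite mul1r sqr_normc_creation_term/=; apply: ler_wpM2r; first exact: sqr_ge0.
    rewrite /kappa/=; have Vk := V0 (tnth X.2 j).
    (* If j = j0 then i differs from i0, and the cutoff bounds the sum of the momentum of particle
       i0 and k. Otherwise boson j survives the removal of j0, and the cutoff bounds its own
       momentum. *)
    have [jj0|jj0] := eqVneq j j0.
      have ii0 : i0 != i by apply/eqP => e; move: pn; rewrite -e jj0 /p0 eqxx.
      rewrite jj0 k1 mul1r; apply: ler_wpDl; first exact: mulr_ge0.
      suff -> : sqnorm (addRd (tnth X.2 j0) (tnth (Defs.shift X.1 i (tnth X.2 j0)) i0)) <= r.
        by rewrite mul1r.
      apply: le_trans wr; apply: (@le_trans _ _ (sqnorm (tnth (removal i0 j0 X).1 i0))).
        rewrite le_eqVlt; apply/orP; left; apply/eqP; congr sqnorm.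
        apply: eq_from_tnth => l; rewrite !tnth_mktuple (negbTE ii0) eqxx tnth_mktuple.
        exact: addrC.
      rewrite /weight /symbolL (bigD1 i0)//= -addrA; apply: ler_wpDr => //.
      by apply: addr_ge0; apply: sumr_ge0 => l _ //; exact: sqnorm_ge0.
    have [l jl] : exists l, j = lift j0 l.
      by case: (unliftP j0 j) => [l ->|jj]; [exists l|rewrite jj eqxx in jj0].
    suff -> : sqnorm (tnth X.2 j) <= r.
      by rewrite mul1r; apply: ler_wpDr => //; apply: mulr_ge0 => //; exact: mulr_ge0.
    apply: le_trans wr; apply: (@le_trans _ _ (dispersion (tnth (removal i0 j0 X).2 l))).
      by rewrite tnth_mktuple -jl lerDl.
    rewrite /weight /symbolL [X in _ + X](bigD1 l)//= addrCA; apply: ler_wpDr => //.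
    by apply: addr_ge0; apply: sumr_ge0 => m _ //; exact: sqnorm_ge0.
  have H := sum_removal_bound ler01 C0 mkap kap0 mu u0 (fun i Q => hC (tnth Q i0))
    mrest rest0 restle.
  apply: le_lt_trans H _; apply: lte_mul_pinfty => //.
  by rewrite lee_fin mul1r mulr_ge0.
pose tail k := (1 <= sqnorm k)%R%:R * V k / dispersion k.
pose wu (Y : cfg n) := (weight Y <= r)%R%:R * u Y.
have tail0 k : 0 <= tail k by apply: divr_ge0 => //; exact: mulr_ge0.
have wu0 Y : 0 <= wu Y by exact: mulr_ge0.
have mwu : measurable_fun setT wu.
  apply: measurable_funM mu; apply/measurable_bool_fun/measurable_fun_ler.
    exact: mweight.
  exact: measurable_cst.
have mtail : measurable_fun setT tail.
  apply: measurable_funM; last exact: measurable_invr_fun.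
  apply: measurable_funM mV; apply/measurable_bool_fun/measurable_fun_ler.
    exact: measurable_cst.
  exact: ms.
pose N : R := \sum_(p : 'I_M * 'I_n.+1) 1.
have N0 : 0 <= N by apply: sumr_ge0.
have g20 : 0 < g ^+ 2 by rewrite lt_neqAle sqr_ge0 eq_sym sqrf_eq0 g_neq0.
(* The first factor is the constant of [symbolL_removal_le]. In the second, (n+1)/g^2 undoes the
   prefactor of G, [N] comes from Cauchy-Schwarz with unit weights on the remainder, and the factors
   2 from isolating one term. The absolute value of [r] makes [B] nonnegative for every [r]. *)
pose B : R := (2 * `|r| + 2) * (2 * n.+1%:R / g ^+ 2 + 2 * N).
have B0 : 0 <= B.
  apply: mulr_ge0; first by apply: addr_ge0 => //; exact: mulr_ge0.
  by apply: addr_ge0; [apply: divr_ge0; [exact: mulr_ge0|exact: ltW]|exact: mulr_ge0].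
have main_le X : tail (tnth X.2 j0) * wu (removal i0 j0 X) <= B * (LG X + rest X).
  have [chiX|[chiX k1 wr]] := chi01 X.
    have -> : tail (tnth X.2 j0) * wu (removal i0 j0 X) =
        chi X * (V (tnth X.2 j0) / dispersion (tnth X.2 j0) * u (removal i0 j0 X)).
      by rewrite /tail /wu /chi; ring.
    by rewrite chiX mul0r; apply: mulr_ge0 => //; exact: addr_ge0.
  have wr' : weight (removal i0 j0 X) <= `|r| by apply: le_trans wr (ler_norm r).
  have Lle := symbolL_removal_le wr'.
  rewrite /tail /wu k1 wr !mul1r.
  set k0 := tnth X.2 j0; set L := symbolL omega X in Lle *.
  pose t0 := creation_term vhat psi p0 X.
  (* Extension by zero at [p0] lets Cauchy-Schwarz run over the whole index type. *)
  pose t' p := if p != p0 then creation_term vhat psi p X else 0.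
  have FE : creation_sum vhat psi X = t0 + \sum_p t' p.
    by rewrite /creation_sum (bigD1 p0)//= big_mkcond.
  have t0E : Normc.normc t0 ^+ 2 = V k0 * u (removal i0 j0 X).
    exact: sqr_normc_creation_term.
  have restE : \sum_p Normc.normc (t' p) ^+ 2 / 1 = rest X.
    rewrite /rest [RHS]big_mkcond/=; apply: eq_bigr => p _.
    by rewrite /t' divr1 chiX mul1r; case: ifP => // _; rewrite Normc.normc0 expr0n.
  have t'le : Normc.normc (\sum_p t' p) ^+ 2 <= N * rest X.
    by rewrite -restE; exact: (sqr_normc_sum_le t' (fun _ => ltr01)).
  have t0le : Normc.normc t0 ^+ 2 <=
      2 * Normc.normc (creation_sum vhat psi X) ^+ 2 + 2 * (N * rest X).
    have := sqr_normcB_le t0 (- \sum_p t' p); rewrite opprK -FE normcN => H.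
    by apply: le_trans H _; rewrite lerD2l ler_pM2l.
  have LGE : Normc.normc (creation_sum vhat psi X) ^+ 2 = L * (n.+1%:R / g ^+ 2 * LG X).
    rewrite /LG sqr_normc_opG -/L; have Ln0 : L != 0 by rewrite (gt_eqF (L0 X)).
    have : (n.+1%:R : R) != 0 by rewrite pnatr_eq0.
    have := gt_eqF g20; rewrite sqrf_eq0 => /negbT gn0.
    by move: (n.+1%:R : R) => N' N'0; field; rewrite Ln0 N'0 gn0.
  have L1 : 1 <= L by exact: symbolL_ge1.
  have dp : 0 < dispersion k0 by apply: lt_le_trans (dispersion1 k0).
  have c0 : 0 <= 2 * `|r| + 2 by apply: addr_ge0 => //; exact: mulr_ge0.
  rewrite mulrAC -t0E ler_pdivrMr//.
  apply: le_trans t0le _; rewrite LGE.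
  (* As [L] is at least 1, the remainder may carry the same factor [L] as the main part; both are
     then traded for the dispersion. *)
  have nr : N * rest X <= L * (N * rest X) by rewrite ler_peMl// mulr_ge0.
  apply: (@le_trans _ _ (L * (2 * (n.+1%:R / g ^+ 2 * LG X) + 2 * (N * rest X)))).
    rewrite [leRHS]mulrDr; apply: lerD; first by rewrite mulrCA lexx.
    by rewrite [leRHS]mulrCA; apply: ler_wpM2l nr; exact: ler0n.
  have S0 : 0 <= 2 * (n.+1%:R / g ^+ 2 * LG X) + 2 * (N * rest X).
    have ng : 0 <= n.+1%:R / g ^+ 2 by rewrite divr_ge0// ltW.
    by apply: addr_ge0; apply: mulr_ge0 => //; exact: mulr_ge0.
  apply: le_trans (ler_wpM2r S0 Lle) _.
  rewrite [leLHS]mulrAC ler_wpM2r ?(ltW dp)// /B -[leRHS]mulrA ler_wpM2l//.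
  have ng : 0 <= n.+1%:R / g ^+ 2 by rewrite divr_ge0// ltW.
  have a1 : 0 <= (n.+1%:R / g ^+ 2) * rest X by exact: mulr_ge0.
  have a2 : 0 <= N * LG X by exact: mulr_ge0.
  rewrite -[2 * _ / _]mulrA; move: (n.+1%:R / g ^+ 2) (rest X) (LG X) a1 a2 => a b c a1 a2.
  by nra.
pose f (z : cfg n * Rd) := (tail z.2 * wu z.1)%:E.
have mf : measurable_fun setT f.
  apply/measurable_EFinP; apply: measurable_funM.
    exact: measurableT_comp mtail measurable_snd.
  exact: measurableT_comp mwu measurable_fst.
have f0 z : (0 <= f z)%E by rewrite lee_fin mulr_ge0.
have mLGE : measurable_fun setT (fun X => (LG X)%:E) by apply/measurable_EFinP.
have mrE : measurable_fun setT (fun X => (rest X)%:E) by apply/measurable_EFinP.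
have fin : (\int[cmu n.+1]_X f (removal i0 j0 X, tnth X.2 j0) < +oo)%E.
  apply: (@le_lt_trans _ _ (\int[cmu n.+1]_X (B%:E * ((LG X)%:E + (rest X)%:E)))%E).
    apply: ge0_le_integral.
    - exact: measurableT.
    - by move=> X _; exact: f0.
    - apply: (measurableT_comp mf); apply: measurable_fun_pair => /=; [exact: mr|exact: mk].
    - by apply: measurable_funeM; exact: emeasurable_funD mLGE mrE.
    - by move=> X _; rewrite -EFinD -EFinM lee_fin; exact: main_le.
  rewrite (ge0_integralZl_EFin _ measurableT _ (emeasurable_funD mLGE mrE) B0); last first.
    by move=> X _; rewrite -EFinD lee_fin addr_ge0.
  rewrite (ge0_integralD _ measurableT _ mLGE _ mrE).
  - apply: lte_mul_pinfty => //.
    exact: lte_add_pinfty.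
  - by move=> X _; rewrite lee_fin.
  - by move=> X _; rewrite lee_fin.
have mwuE : measurable_fun setT (fun Y => (wu Y)%:E) by apply/measurable_EFinP.
have mtailE : measurable_fun setT (fun k => (tail k)%:E) by apply/measurable_EFinP.
have I0 : (\int[cmu n]_Y (wu Y)%:E = 0)%E.
  have Ige0 : (0 <= \int[cmu n]_Y (wu Y)%:E)%E.
    by apply: integral_ge0 => Y _; rewrite lee_fin.
  have E : (\int[cmu n.+1]_X f (removal i0 j0 X, tnth X.2 j0) =
      +oo * \int[cmu n]_Y (wu Y)%:E)%E.
    rewrite (integral_removal i0 j0 mf f0).
    rewrite -(ge0_integralZl (cmu n) measurableT mwuE _ (leey _)); last first.
      by move=> Y _; rewrite lee_fin.
    apply: eq_integral => Y _; rewrite -(form_integral_tail foo) muleC.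
    rewrite -(ge0_integralZl_EFin _ measurableT _ mtailE (wu0 Y)); last first.
      by move=> k _; rewrite lee_fin.
    by apply: eq_integral => k _; rewrite /f -EFinM mulrC.
  (* The product of +oo and 0 is 0 here, so only positive mass contradicts finiteness. *)
  apply/eqP; rewrite eq_le Ige0 andbT leNgt; apply/negP => Igt0.
  by move: fin; rewrite E gt0_mulye.
have H : (\int[cmu n]_Y `|(wu Y)%:E| = 0)%E.
  rewrite -[RHS]I0; apply: eq_integral => Y _.
  by rewrite gee0_abs// lee_fin.
have [H1 _] := ae_eq_integral_abs (cmu n) measurableT mwuE.
by apply: filterS (H1 H) => Y /(_ Logic.I) [].
Qed.

End vanishing.

(** * Summable recursions and weighted L^2 estimates *)

(** Summed from [N] on, the recursion bounds the partial sum S by a constant plus half of S, and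
    that half is absorbed on the left; hence the factor 2 in the bound. *)
Lemma recursion_bounded (R : realFieldType) (s c e : nat -> R) (B : R) (N : nat) :
  (forall n, 0 <= s n) -> (forall n, 0 <= c n) ->
  (forall n, s n.+1 <= c n.+1 + e n * s n) ->
  (forall n, (N <= n)%N -> e n <= 1 / 2) ->
  (forall K, \sum_(0 <= n < K) c n <= B) ->
  exists B', forall K, \sum_(0 <= n < K) s n <= B'.
Proof.
move=> s0 c0 rec eN cB.
pose S K := \sum_(0 <= n < K) s n.
have SS K : S K.+1 = S K + s K by rewrite /S big_nat_recr.
have S0 K : 0 <= S K by rewrite /S sumr_ge0.
have B0 : 0 <= B by have := cB 0%N; rewrite big_geq.
have step m : S (N + m).+1 <=
    S N.+1 + \sum_(0 <= n < (N + m).+1) c n + 1 / 2 * S (N + m)%N.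
  elim: m => [|m IH].
    rewrite addn0 -addrA lerDl addr_ge0//; first by rewrite sumr_ge0.
    by rewrite mulr_ge0// divr_ge0.
  rewrite addnS SS big_nat_recr//= SS.
  have h1 := rec (N + m)%N; have h2 : e (N + m)%N * s (N + m)%N <= 1 / 2 * s (N + m)%N.
    by rewrite ler_wpM2r// eN// leq_addr.
  by move: IH; rewrite SS; lra.
have S2 m : S (N + m).+1 <= 2 * (S N.+1 + B).
  have h1 := step m; have h2 := cB (N + m).+1; have h3 := s0 (N + m)%N.
  by move: h1; rewrite SS; lra.
exists (2 * (S N.+1 + B)) => K; apply: le_trans (S2 K); rewrite -/(S K).
rewrite /S [leRHS](big_cat_nat _ (n := K))//=; first by rewrite lerDl sumr_ge0.
by rewrite ltnW// ltnS leq_addl.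
Qed.

Lemma powR_decay (R : realType) (C dl : R) : 0 <= C -> 0 < dl ->
  exists N, forall n, (N <= n)%N -> C * n.+1%:R `^ (- dl) <= 1 / 2.
Proof.
move=> C0 dl0; have C20 : 0 <= 2 * C by exact: mulr_ge0.
(* The threshold solves 2 C <= x^dl for x. *)
exists (Num.bound ((2 * C) `^ dl^-1)) => n Nn.
have h1 : (2 * C) `^ dl^-1 <= n.+1%:R.
  apply: le_trans (ltW (archi_boundP (powR_ge0 _ _))) _.
  by rewrite ler_nat ltnW.
have h2 : 2 * C <= n.+1%:R `^ dl.
  have <- : ((2 * C) `^ dl^-1) `^ dl = 2 * C.
    by rewrite -powRrM mulVf ?powRr1// lt0r_neq0.
  apply: (ge0_ler_powR (ltW dl0)) h1; rewrite nnegrE ?powR_ge0//.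
rewrite powRN ler_pdivrMr ?powR_gt0//.
by rewrite mulrC mulrA mulr1 ler_pdivlMr// mulrC.
Qed.

Section sqnormL2.
Context (R : realType) e (T : measurableType e) (mu : {measure set T -> \bar R}).
Implicit Types f h : T -> R[i].

Lemma sqnormL2_ge0 f : (0 <= sqnormL2 mu f)%E.
Proof. by apply: integral_ge0 => x _; rewrite lee_fin sqr_ge0. Qed.

Lemma sqnormL2_fin f : (sqnormL2 mu f < +oo)%E ->
  sqnormL2 mu f = (fine (sqnormL2 mu f))%:E.
Proof. by move=> foo; rewrite fineK// ge0_fin_numE// sqnormL2_ge0. Qed.

Lemma sqnormL2_le f h (c : R) : 0 <= c -> cmeasurable f -> cmeasurable h ->
  (forall x, Normc.normc (f x) ^+ 2 <= c * Normc.normc (h x) ^+ 2) ->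
  (sqnormL2 mu f <= c%:E * sqnormL2 mu h)%E.
Proof.
move=> c0 mf mh fh.
have mhE : measurable_fun setT (fun x => (Normc.normc (h x) ^+ 2)%:E).
  by apply/measurable_EFinP; exact: measurable_sqr_normc.
rewrite -(ge0_integralZl_EFin _ measurableT _ mhE c0); last first.
  by move=> x _; rewrite lee_fin sqr_ge0.
apply: ge0_le_integral.
- exact: measurableT.
- by move=> x _; rewrite lee_fin sqr_ge0.
- by apply/measurable_EFinP; exact: measurable_sqr_normc.
- exact: measurable_funeM.
- by move=> x _; rewrite -EFinM lee_fin.
Qed.

Lemma sqnormL2_eq0 f : cmeasurable f ->
  sqnormL2 mu f = 0%E <-> {ae mu, forall x, f x = 0}.
Proof.
move=> mf.
have mfE : measurable_fun setT (fun x => (Normc.normc (f x) ^+ 2)%:E).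
  by apply/measurable_EFinP; exact: measurable_sqr_normc.
have -> : sqnormL2 mu f = (\int[mu]_x `|(Normc.normc (f x) ^+ 2)%:E|)%E.
  by apply: eq_integral => x _; rewrite gee0_abs// lee_fin sqr_ge0.
have [H1 H2] := ae_eq_integral_abs mu measurableT mfE.
split=> [/H1|H].
  apply: filterS => x /(_ Logic.I) [] /eqP.
  by rewrite sqrf_eq0 => /eqP /Normc.eq0_normc.
by apply: H2; apply: filterS H => x -> _; rewrite Normc.normc0 expr0n.
Qed.

Lemma sqnormL2_triangle f h : cmeasurable f -> cmeasurable h ->
  (sqnormL2 mu f <= 2%:E * (sqnormL2 mu (fun x => f x - h x)%R + sqnormL2 mu h))%E.
Proof.
move=> mf mh; have mfh := cmeasurable_sub mf mh.
pose f2 x := (Normc.normc (f x - h x) ^+ 2)%:E.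
pose f3 x := (Normc.normc (h x) ^+ 2)%:E.
have m2 : measurable_fun setT f2.
  by apply/measurable_EFinP; exact: measurable_sqr_normc.
have m3 : measurable_fun setT f3.
  by apply/measurable_EFinP; exact: measurable_sqr_normc.
have f20 x : (0 <= f2 x)%E by rewrite lee_fin sqr_ge0.
have f30 x : (0 <= f3 x)%E by rewrite lee_fin sqr_ge0.
have m23 : measurable_fun setT (fun x => f2 x + f3 x)%E by exact: emeasurable_funD.
rewrite /sqnormL2 -(ge0_integralD mu measurableT (fun x _ => f20 x) m2 (fun x _ => f30 x) m3).
rewrite -(ge0_integralZl_EFin _ measurableT _ m23 (ler0n R 2)); last first.
  by move=> x _; exact: adde_ge0.
apply: ge0_le_integral.
- exact: measurableT.
- by move=> x _; rewrite lee_fin sqr_ge0.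
- by apply/measurable_EFinP; exact: measurable_sqr_normc.
- exact: measurable_funeM.
by move=> x _; rewrite -EFinD -EFinM lee_fin mulrDr sqr_normcB_le.
Qed.

(* From m <= 1 + m^2. *)
Lemma sqrt_weight_triangle (m : T -> R) f h :
  measurable_fun setT m -> (forall x, 0 <= m x) -> cmeasurable f -> cmeasurable h ->
  (\int[mu]_x (m x * Normc.normc (f x) ^+ 2)%:E <=
   2%:E * (\int[mu]_x (m x * Normc.normc (h x) ^+ 2)%:E +
     (sqnormL2 mu (fun x => f x - h x)%R +
      sqnormL2 mu (fun x => (m x)%:C * (f x - h x))%R)))%E.
Proof.
move=> mm m0 mf mh; have mfh := cmeasurable_sub mf mh.
pose f1 x := (m x * Normc.normc (h x) ^+ 2)%:E.
pose f2 x := (Normc.normc (f x - h x) ^+ 2)%:E.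
pose f3 x := (Normc.normc ((m x)%:C * (f x - h x)) ^+ 2)%:E.
have m1 : measurable_fun setT f1.
  by apply/measurable_EFinP; apply: measurable_funM => //; exact: measurable_sqr_normc.
have m2 : measurable_fun setT f2.
  by apply/measurable_EFinP; exact: measurable_sqr_normc.
have m3 : measurable_fun setT f3.
  apply/measurable_EFinP; apply: measurable_sqr_normc.
  exact: cmeasurable_mul (cmeasurable_real mm) mfh.
have f10 x : (0 <= f1 x)%E by rewrite lee_fin mulr_ge0// sqr_ge0.
have f20 x : (0 <= f2 x)%E by rewrite lee_fin sqr_ge0.
have f30 x : (0 <= f3 x)%E by rewrite lee_fin sqr_ge0.
have := ge0_integral_lin mu ler01 m1 m2 m3 f10 f20 f30.
rewrite [X in _ = X -> _](_ : _ = (\int[mu]_x f1 x + (\int[mu]_x f2 x + \int[mu]_x f3 x))%E);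
  last by rewrite mul1e.
rewrite /sqnormL2 => <-.
have mS : measurable_fun setT (fun x => f1 x + 1%:E * (f2 x + f3 x))%E.
  by apply: emeasurable_funD m1 _; apply: measurable_funeM; exact: emeasurable_funD.
rewrite -(ge0_integralZl_EFin _ measurableT _ mS (ler0n R 2)); last first.
  by move=> x _; rewrite mul1e; apply: adde_ge0 => //; exact: adde_ge0.
apply: ge0_le_integral.
- exact: measurableT.
- by move=> x _; rewrite lee_fin mulr_ge0// sqr_ge0.
- by apply/measurable_EFinP; apply: measurable_funM => //; exact: measurable_sqr_normc.
- exact: measurable_funeM.
move=> x _; rewrite mul1e /f1 /f2 /f3 sqr_normc_scale -!EFinD -EFinM lee_fin.
have := sqr_normcB_le (f x) (h x); have := m0 x.
have := sqr_ge0 (Normc.normc (f x - h x)).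
move: (Normc.normc (f x) ^+ 2) (Normc.normc (h x) ^+ 2) (Normc.normc (f x - h x) ^+ 2).
move=> a b c c0 mx abc.
have h1 : m x * a <= m x * (2 * c + 2 * b) by exact: ler_wpM2l.
have h2 : 0 <= c * (m x - 1) ^+ 2 by rewrite mulr_ge0// sqr_ge0.
have h3 : 0 <= m x * c by exact: mulr_ge0.
have h4 : 0 <= c * m x ^+ 2 by rewrite mulr_ge0// sqr_ge0.
by nra.
Qed.

End sqnormL2.

(** * Membership in the domains *)

Section hilbert_lemmas.
Variables (R : realType) (d M : nat).
Local Notation Rd := (Rd R d).
Local Notation cfg := (config R d M).
Local Notation cmu := (config_measure R d M).
Implicit Types psi : fock R d M.

Lemma hilbert_sector_fin psi n : hilbert psi -> (sqnormL2 (cmu n) (psi n) < +oo)%E.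
Proof.
move=> [_ _ psi2]; apply: le_lt_trans psi2.
have := @nneseries_lim_ge R (fun n => sqnormL2 (cmu n) (psi n)) xpredT 0 n.+1
  (fun n _ _ => sqnormL2_ge0 _ _).
apply: le_trans; rewrite big_nat_recr//=.
by apply: leeDr; apply: sume_ge0 => i _; exact: sqnormL2_ge0.
Qed.

Lemma hilbert_partial_sums psi : hilbert psi -> exists B : R,
  forall K, \sum_(0 <= n < K) fine (sqnormL2 (cmu n) (psi n)) <= B.
Proof.
move=> hpsi; have [_ _ psi2] := hpsi.
have S0 : (0 <= \sum_(0 <= n <oo) sqnormL2 (cmu n) (psi n))%E.
  by apply: nneseries_ge0 => n _ _; exact: sqnormL2_ge0.
exists (fine (\sum_(0 <= n <oo) sqnormL2 (cmu n) (psi n))%E) => K.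
rewrite -lee_fin fineK ?ge0_fin_numE// -sumEFin.
have := @nneseries_lim_ge R (fun n => sqnormL2 (cmu n) (psi n)) xpredT 0 K
  (fun n _ _ => sqnormL2_ge0 _ _).
apply: le_trans; apply: lee_sum => n _.
by rewrite -sqnormL2_fin//; exact: hilbert_sector_fin.
Qed.

Lemma hilbert_of_sums psi (t : nat -> R) (B : R) :
  (forall n, cmeasurable (psi n)) ->
  (forall n (s : 'S_n), {ae cmu n, forall X, psi n (X.1, permute s X.2) = psi n X}) ->
  (forall n, sqnormL2 (cmu n) (psi n) <= (t n)%:E)%E ->
  (forall K, \sum_(0 <= n < K) t n <= B) -> hilbert psi.
Proof.
move=> mpsi spsi tpsi tB; split=> //.
apply: (@le_lt_trans _ _ B%:E); last exact: ltry.
apply: nneseries_le_bound => [n|K]; first exact: sqnormL2_ge0.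
apply: (@le_trans _ _ (\sum_(0 <= i < K) (t i)%:E)%E).
  by apply: lee_sum => i _; exact: tpsi.
by rewrite sumEFin lee_fin.
Qed.

Lemma measurable_config_permute n (s : 'S_n) :
  measurable_fun setT (fun X : cfg n => (X.1, permute s X.2)).
Proof.
apply: measurable_fun_pair => //=.
exact: measurableT_comp (@measurable_tuple_permute _ Rd n s) measurable_snd.
Qed.

Lemma integral_config_permute n (s : 'S_n) (f : cfg n -> \bar R) :
  measurable_fun setT f -> (forall X, 0 <= f X)%E ->
  (\int[cmu n]_X f (X.1, permute s X.2) = \int[cmu n]_X f X)%E.
Proof.
move=> mf f0.
have mfs : measurable_fun setT (fun X : cfg n => f (X.1, permute s X.2)).
  exact: measurableT_comp mf (measurable_config_permute s).
apply: (eq_trans (fubini_tonelli1 _ mfs (fun X => f0 _))).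
apply: (eq_trans _ (esym (fubini_tonelli1 _ mf f0))).
apply: eq_integral => P _.
apply: (integral_tuple_permute (leb R d) s (f := fun K => f (P, K))).
  exact: measurableT_comp mf (pair1_measurable P).
by move=> K; exact: f0.
Qed.

(** Symmetry is the one clause that needs an argument: [psi] after a permutation also vanishes
    almost everywhere because permutations preserve the measure. *)
Lemma zero_hilbert psi : (forall n, cmeasurable (psi n)) ->
  (forall n, {ae cmu n, forall X, psi n X = 0}) -> hilbert psi.
Proof.
move=> mpsi psi0.
have z n : sqnormL2 (cmu n) (psi n) = 0%E by exact: (sqnormL2_eq0 _ (mpsi n)).2 (psi0 n).
apply: (@hilbert_of_sums psi (fun=> 0) 0) => //.
- move=> n s.
  have mps : cmeasurable (fun X : cfg n => psi n (X.1, permute s X.2)).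
    exact: cmeasurable_comp (mpsi n) (measurable_config_permute s).
  have ps0 : {ae cmu n, forall X, psi n (X.1, permute s X.2) = 0}.
    apply: (sqnormL2_eq0 (cmu n) mps).1; rewrite -[RHS](z n).
    apply: (integral_config_permute s (f := fun X => (Normc.normc (psi n X) ^+ 2)%:E)).
      by apply/measurable_EFinP; exact: measurable_sqr_normc.
    by move=> X; rewrite lee_fin sqr_ge0.
  by apply: filterS2 ps0 (psi0 n) => X -> ->.
- by move=> n; rewrite z.
- by move=> K; rewrite big1.
Qed.

Lemma vacuum_hilbert psi : cmeasurable (psi 0%N) ->
  (forall n X, psi n.+1 X = 0) -> (sqnormL2 (cmu 0%N) (psi 0%N) < +oo)%E ->
  hilbert psi.
Proof.
move=> mpsi psi0 psi2.
have t0 : 0 <= fine (sqnormL2 (cmu 0%N) (psi 0%N)) by apply: fine_ge0; exact: sqnormL2_ge0.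
apply: (@hilbert_of_sums psi
  (fun n => if n is 0 then fine (sqnormL2 (cmu 0%N) (psi 0%N)) else 0)
  (fine (sqnormL2 (cmu 0%N) (psi 0%N)))).
- case=> // n; rewrite (_ : psi n.+1 = fun=> 0); last exact/funext.
  exact: cmeasurable_cst.
- case=> [|n] s; apply: aeW => X; last by rewrite !psi0.
  by congr (psi _ _); case: X => P K; congr (_, _); apply: eq_from_tnth => -[].
- case=> [|n]; first by rewrite -sqnormL2_fin.
  rewrite /sqnormL2 integral0_eq// => X _.
  by rewrite psi0 Normc.normc0 expr0n.
case=> [|K]; first by rewrite big_geq.
by rewrite big_nat_recl//= big1 ?addr0.
Qed.

End hilbert_lemmas.

(** * Comparing D(H) with D(L^(1/2)) *)

Section main.
Variables (R : realType) (d M : nat) (g : R).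
Variables (vhat : Rd R d -> R[i]) (omega : Rd R d -> R) (alpha beta : R).
Local Notation Rd := (Rd R d).
Local Notation cfg := (config R d M).
Local Notation cmu := (config_measure R d M).
Local Notation G := (opG omega g vhat).
Hypothesis mvhat : cmeasurable vhat.
Hypothesis momega : measurable_fun setT omega.
Hypothesis vhat_le : {ae leb R d, forall k,
  Normc.normc (vhat k) <= Num.sqrt (sqnorm k) `^ (- alpha)}.
Hypothesis omega_ge : forall k, (1 + sqnorm k) `^ (beta / 2) <= omega k.
Hypothesis alpha0 : 0 <= alpha.
Hypothesis alphad : alpha < d%:R / 2.
Hypothesis beta0 : 0 <= beta.
Hypothesis gap : d%:R / 2 < alpha + beta / 2 + 1.

Let omega1 k : 1 <= omega k. Proof. exact: omega_ge1 omega_ge beta0 k. Qed.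
Let omega0 k : 0 <= omega k. Proof. exact: le_trans (omega1 k). Qed.
Let L0 n (X : cfg n) : 0 <= symbolL omega X. Proof. exact: symbolL_ge0. Qed.
Let mL n : measurable_fun setT (@symbolL R d M omega n).
Proof. exact: measurable_symbolL. Qed.

Let msqrtL n : measurable_fun setT (fun X : cfg n => Num.sqrt (symbolL omega X)).
Proof. exact: measurable_sqrt_fun (@L0 n) (@mL n). Qed.

Let sqnorm_sqrtL (psi : fock R d M) n :
  sqnormL2 (cmu n) (multiplication (fun n X => Num.sqrt (symbolL omega X)) psi (n := n)) =
  (\int[cmu n]_X (symbolL omega X * Normc.normc (psi n X) ^+ 2)%:E)%E.
Proof.
apply: eq_integral => X _.
by rewrite /multiplication sqr_normc_scale sqr_sqrtr.
Qed.

(** The bound on L^(1/2) G psi grows like n, so the sequence to be summed is (n+1) times the squared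
    norm of sector n of psi. It satisfies a recursion whose source is L (psi - G psi) and whose
    coefficient decays like that of G. *)
Lemma domH_domLhalf : d%:R / 2 < alpha + 1 ->
  domH M omega g vhat `<=` domLhalf M omega.
Proof.
move=> gap1 psi [hpsi hdom]; split; first exact: hpsi.
have [mpsi spsi _] := hpsi.
pose phi : fock R d M := fun n X => psi n X - G psi X.
have [hphi hLphi] : hilbert phi /\ hilbert (multiplication (@symbolL R d M omega) phi).
  exact: hdom.
have [C [dl [C0 dl0 hC]]] := opG_bound M g mvhat momega vhat_le omega_ge alpha0 alphad beta0 gap.
have [D D0 hD] := sqrt_opG_bound M g mvhat momega vhat_le omega_ge alpha0 alphad beta0 gap1.
pose a n := fine (sqnormL2 (cmu n) (psi n)).
pose b n := fine (sqnormL2 (cmu n) (phi n)).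
pose c n := fine (sqnormL2 (cmu n) (multiplication (@symbolL R d M omega) phi (n := n))).
have aE n : sqnormL2 (cmu n) (psi n) = (a n)%:E by exact/sqnormL2_fin/hilbert_sector_fin.
have bE n : sqnormL2 (cmu n) (phi n) = (b n)%:E by exact/sqnormL2_fin/hilbert_sector_fin.
have cE n : sqnormL2 (cmu n) (multiplication (@symbolL R d M omega) phi (n := n)) = (c n)%:E.
  exact/sqnormL2_fin/hilbert_sector_fin.
have a0 n : 0 <= a n by apply: fine_ge0; exact: sqnormL2_ge0.
have b0 n : 0 <= b n by apply: fine_ge0; exact: sqnormL2_ge0.
have c0 n : 0 <= c n by apply: fine_ge0; exact: sqnormL2_ge0.
have [Bb hBb] := hilbert_partial_sums hphi.
have [Bc hBc] := hilbert_partial_sums hLphi.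
have mG n : cmeasurable (G psi (n := n)) by exact: cmeasurable_opG.
have [mphi _ _] := hphi; have [mLphi _ _] := hLphi.
pose e n := C * n.+1%:R `^ (- dl).
have e0 n : 0 <= e n by rewrite mulr_ge0 ?powR_ge0.
have arec n : a n.+1 <= 2 * b n.+1 + 2 * (e n * a n).
  have h1 := sqnormL2_triangle (cmu n.+1) (mpsi n.+1) (mG n.+1).
  have h2 := hC psi n mpsi.
  rewrite aE -EFinM in h2; rewrite aE [X in (_ <= _ * (X + _))%E]bE in h1.
  have Gf := sqnormL2_fin (le_lt_trans h2 (ltry _)).
  rewrite Gf lee_fin in h2; rewrite Gf -EFinD -EFinM lee_fin in h1.
  apply: le_trans h1 _; rewrite mulrDr lerD2l ler_pM2l//.
(* On sector n+1, n+1 <= L <= L^2, so the weight n+1 is paid for by the norm of L phi. *)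
have bc n : n.+1%:R * b n.+1 <= c n.+1.
  have n0 : 0 < (n.+1%:R : R) by exact: ltr0Sn.
  have i0 : 0 <= (n.+1%:R : R)^-1 by rewrite invr_ge0.
  rewrite -ler_pdivlMl//.
  have := @sqnormL2_le _ _ _ (cmu n.+1) (phi n.+1)
    (multiplication (@symbolL R d M omega) phi (n := n.+1)) (n.+1%:R)^-1 i0
    (mphi n.+1) (mLphi n.+1).
  rewrite bE cE -EFinM lee_fin; apply=> X; rewrite /multiplication sqr_normc_scale mulrA ler_peMl ?sqr_ge0//.
  rewrite ler_pdivlMl// mulr1.
  have nL := symbolL_ge_card omega1 X.
  apply: le_trans nL _; apply: ler_eXnr => //; exact: symbolL_ge1.
pose s n := n.+1%:R * a n.
have s0 n : 0 <= s n by exact: mulr_ge0.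
(* Each 4 is the 2 of the triangle inequality times the 2 in n+2 <= 2(n+1). *)
have srec n : s n.+1 <= 4 * c n.+1 + 4 * e n * s n.
  have h1 := arec n; have h2 := bc n.
  have n2 : (n.+2%:R : R) <= 2 * n.+1%:R by rewrite -natrM ler_nat mul2n -addnn addSn ltnS leq_addl.
  have r0 : 0 <= 2 * b n.+1 + 2 * (e n * a n).
    by rewrite addr_ge0// mulr_ge0// mulr_ge0.
  have h3 : s n.+1 <= n.+2%:R * (2 * b n.+1 + 2 * (e n * a n)).
    by rewrite ler_wpM2l.
  have h4 := ler_wpM2r r0 n2.
  apply: le_trans (le_trans h3 h4) _; rewrite /s.
  apply: (@le_trans _ _ (4 * (n.+1%:R * b n.+1) + 4 * e n * (n.+1%:R * a n))).
    by rewrite le_eqVlt; apply/orP; left; apply/eqP; ring.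
  by rewrite lerD2r ler_pM2l.
have [N hN] := powR_decay (mulr_ge0 (ler0n R 4) C0) dl0.
have [Bs hBs] : exists Bs, forall K, \sum_(0 <= n < K) s n <= Bs.
  apply: (@recursion_bounded R s (fun n => 4 * c n) (fun n => 4 * e n) (4 * Bc) N) => //.
  - by move=> n; exact: mulr_ge0.
  - by move=> n Nn; rewrite /e mulrA; exact: hN.
  - by move=> K; rewrite -mulr_sumr ler_pM2l.
(* Index shift: sector n of G psi is controlled by sector n-1 of psi, and sector 0 of G psi is
   zero. *)
pose s' n : R := if n is n'.+1 then s n' else 0.
have s'0 n : 0 <= s' n by case: n.
have hBs' K : \sum_(0 <= n < K) s' n <= Bs.
  case: K => [|K]; first by have := hBs 0%N; rewrite !big_geq.
  by rewrite big_nat_recl//= add0r.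
have tle n : (sqnormL2 (cmu n) (multiplication (fun n X => Num.sqrt (symbolL omega X)) psi
    (n := n)) <= (2 * (D * s' n + (b n + c n)))%:E)%E.
  have h1 := sqrt_weight_triangle (cmu n) (@mL n) (@L0 n) (mpsi n) (mG n).
  rewrite sqnorm_sqrtL; apply: le_trans h1 _.
  rewrite [X in (_ * (_ + (X + _)) <= _)%E]bE [X in (_ * (_ + (_ + X)) <= _)%E]cE.
  rewrite EFinM; apply: lee_wpmul2l; first by rewrite lee_fin.
  rewrite EFinD; apply: leeD; last by rewrite EFinD.
  case: n => [|n].
    rewrite mulr0 integral0_eq// => X _.
    by rewrite /opG Normc.normc0 expr0n mulr0.
  by have := hD psi n mpsi; rewrite aE -EFinM -mulrA.
apply: (@hilbert_of_sums _ _ _ _ (fun n => 2 * (D * s' n + (b n + c n)))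
  (2 * (D * Bs + (Bb + Bc)))) => //.
- by move=> n; exact: (cmeasurable_mul (cmeasurable_real (@msqrtL n)) (mpsi n)).
- move=> n t; apply: filterS (spsi n t) => X psiX.
  by rewrite /multiplication psiX symbolL_permute.
- move=> K; rewrite -mulr_sumr ler_pM2l// big_split/= -mulr_sumr big_split/=.
  by apply: lerD; [exact: ler_wpM2l|exact: lerD].
Qed.

(** [opG] acts on representatives; its norm bound shows that it sends null functions to null
    functions. *)
Lemma zero_class_opG (psi : fock R d M) n : (forall n, cmeasurable (psi n)) ->
  (forall n, {ae cmu n, forall X, psi n X = 0}) ->
  {ae cmu n, forall X, G psi (n := n) X = 0}.
Proof.
move=> mpsi psi0; case: n => [|n]; first exact: aeW.
have [C [dl [C0 dl0 hC]]] := opG_bound M g mvhat momega vhat_le omega_ge alpha0 alphad beta0 gap.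
have mG : cmeasurable (G psi (n := n.+1)) by exact: cmeasurable_opG.
apply: (sqnormL2_eq0 (cmu n.+1) mG).1; apply/eqP.
rewrite eq_le sqnormL2_ge0 andbT; apply: le_trans (hC psi n mpsi) _.
by rewrite ((sqnormL2_eq0 (cmu n) (mpsi n)).2 (psi0 n)) mule0.
Qed.

(** [sqrt_weight_triangle] is used with the roles of psi and G psi exchanged: it yields a finite
    norm of L^(1/2) G psi in each sector, which is what [sector_vanishes] requires. The index [i0]
    supplies a particle to absorb the boson. *)
Lemma domH_domLhalf_zero (i0 : 'I_M) : g != 0 ->
  form_integral vhat omega = +oo%E ->
  domH M omega g vhat `&` domLhalf M omega = zero_class R d M.
Proof.
move=> g0 foo; apply/seteqP; split=> psi.
  move=> [[hpsi hdom] [_ hsqrt]]; split; first exact: hpsi.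
  have [mpsi _ _] := hpsi.
  pose phi : fock R d M := fun n X => psi n X - G psi X.
  have [hphi hLphi] : hilbert phi /\ hilbert (multiplication (@symbolL R d M omega) phi).
    exact: hdom.
  move=> n; apply: (sector_vanishes g0 mvhat momega vhat_le omega1 alpha0 alphad i0 foo mpsi).
    exact: hilbert_sector_fin.
  have mG m : cmeasurable (G psi (n := m)) by exact: cmeasurable_opG.
  (* Exchanging the roles reverses the sign of the difference, which the norm ignores. *)
  have B (f h : cfg n.+1 -> R[i]) : (forall X, f X = - h X) ->
      sqnormL2 (cmu n.+1) f = sqnormL2 (cmu n.+1) h.
    by move=> fh; apply: eq_integral => X _; rewrite fh normcN.
  have E1 : sqnormL2 (cmu n.+1) (fun X => G psi X - psi n.+1 X) =
      sqnormL2 (cmu n.+1) (phi n.+1) by apply: B => X; rewrite opprB.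
  have E2 : sqnormL2 (cmu n.+1) (fun X => (symbolL omega X)%:C * (G psi X - psi n.+1 X)) =
      sqnormL2 (cmu n.+1) (multiplication (@symbolL R d M omega) phi (n := n.+1)).
    by apply: B => X; rewrite /multiplication -mulrN opprB.
  have E3 := sqnorm_sqrtL psi n.+1.
  have := sqrt_weight_triangle (cmu n.+1) (@mL n.+1) (@L0 n.+1) (mG n.+1) (mpsi n.+1).
  rewrite E1 E2 -E3 => h; apply: (le_lt_trans h).
  apply: lte_mul_pinfty => //; apply: lte_add_pinfty.
    exact: (hilbert_sector_fin n.+1 hsqrt).
  by apply: lte_add_pinfty; [exact: (hilbert_sector_fin n.+1 hphi)|
    exact: (hilbert_sector_fin n.+1 hLphi)].
move=> [hpsi psi0]; have [mpsi _ _] := hpsi.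
have mG n : cmeasurable (G psi (n := n)) by exact: cmeasurable_opG.
have mphi n : cmeasurable (fun X => psi n X - G psi X) by exact: cmeasurable_sub.
have phi0 n : {ae cmu n, forall X, psi n X - G psi X = 0}.
  by apply: filterS2 (psi0 n) (zero_class_opG n mpsi psi0) => X -> ->; rewrite subrr.
split; split.
- exact: hpsi.
- split; first exact: zero_hilbert.
  apply: zero_hilbert => n; first exact: (cmeasurable_mul (cmeasurable_real (@mL n)) (mphi n)).
  by apply: filterS (phi0 n) => X phiX; rewrite /multiplication phiX mulr0.
- exact: hpsi.
apply: zero_hilbert => n; first exact: (cmeasurable_mul (cmeasurable_real (@msqrtL n)) (mpsi n)).
by apply: filterS (psi0 n) => X psiX; rewrite /multiplication psiX mulr0.
Qed.

(** * A nonzero element of D(H) *)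

Section nonzero_element.

(* The solution of psi - G psi = f with f supported in the vacuum sector. *)
Fixpoint iterG (f : cfg 0 -> R[i]) n : cfg n -> R[i] :=
  match n with
  | 0 => f
  | m.+1 => fun X => (- g / Num.sqrt m.+1%:R)%:C *
      \sum_(i < M) \sum_(j < m.+1) vhat (tnth X.2 j) *
        iterG f (removal i j X) / (symbolL omega X)%:C
  end.

Lemma iterGS f n (X : cfg n.+1) : iterG f X = G (iterG f) X.
Proof. by []. Qed.

Lemma cmeasurable_iterG f n : cmeasurable f -> cmeasurable (@iterG f n).
Proof.
move=> mf; elim: n => [//|n IH].
exact: (cmeasurable_opGS g mvhat momega omega1 (psi := iterG f) IH).
Qed.

(** The sum defining G runs over all bosons, so a permutation only reindexes it and permutes each
    remaining configuration, which the induction handles. Symmetry holds at every point. *)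
Lemma iterG_permute f n (s : 'S_n) P K :
  iterG f (P, permute s K) = iterG f (P, K).
Proof.
elim: n s P K => [|n IH] s P K.
  by congr (f (_, _)); apply: eq_from_tnth => -[].
rewrite !iterGS !opG_creation (symbolL_permute omega s (P, K)); congr (_ * _).
pose h (t : 'S_n.+1) (p : 'I_M * 'I_n.+1) := (p.1, t p.2).
have hK : cancel (h s) (h s^-1%g) by move=> [i j]; rewrite /h/= permK.
rewrite /creation_sum [RHS](reindex_inj (can_inj hK))/=.
apply: eq_bigr => -[i j] _; rewrite /creation_term /removal /h/= tnth_mktuple.
have [s' s'E] := @tuple_delete_permute _ Rd n s j.
by rewrite (s'E K : delete (permute s K) j = _) IH.
Qed.

(** The sector without bosons still carries the particle momenta. A bounded box keeps L bounded on
    the source, and its positive finite measure makes the source a nonzero vector. *)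
Definition vacuum_box : set (cfg 0) :=
  [set X | forall l, cube 1 (tnth X.1 l)].

Lemma vacuum_box_measure : measurable vacuum_box /\
  cmu 0%N vacuum_box = (((2 ^+ d) ^+ M)%:E)%E.
Proof.
have [mC leC] := @cube_measure R d 1 ler01.
have [mB muB] := tuple_measure_cube (leb R d) M mC.
have E : vacuum_box = [set t : M.-tuple Rd | forall i, cube 1 (tnth t i)] `*` setT.
  by apply/seteqP; split=> -[P K] /=; [|case].
rewrite E; split; first exact: measurableX.
apply: (eq_trans (product_measure1E _ _ mB measurableT)).
transitivity (((((2 * 1) ^+ d : R))%:E ^+ M) * 1)%E; last by rewrite mule1 mulr1 [RHS]EFin_expe.
congr (_ * _)%E; first by rewrite -leC; exact: muB.
by rewrite /= diracE mem_set.
Qed.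

(** Beyond the vacuum sector psi - G psi vanishes identically, so membership in D(L) concerns the
    indicator of the box alone. Square summability of psi comes from [recursion_bounded] with zero
    source. *)
Lemma iterG_in_domH : exists psi : fock R d M,
  domH M omega g vhat psi /\ ~ zero_class R d M psi.
Proof.
have [mA muA] := vacuum_box_measure.
pose f (X : cfg 0) : R[i] := (\1_vacuum_box X)%:C.
have m1A : measurable_fun setT (\1_vacuum_box : cfg 0 -> R) by exact: measurable_indic.
have mf : cmeasurable f by exact: cmeasurable_real.
have fE : sqnormL2 (cmu 0%N) f = ((2 ^+ d) ^+ M)%:E.
  rewrite -muA -(setIT vacuum_box) -(integral_indic (cmu 0%N) measurableT mA).
  apply: eq_integral => X _; rewrite /f normc_real indicE; congr EFin.
  by case: (_ \in _); rewrite ?normr1 ?normr0 ?expr1n ?expr0n.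
pose psi : fock R d M := iterG f.
have mpsi n : cmeasurable (psi n) by exact: cmeasurable_iterG.
have [C [dl [C0 dl0 hC]]] := opG_bound M g mvhat momega vhat_le omega_ge alpha0 alphad beta0 gap.
have psi_fin n : (sqnormL2 (cmu n) (psi n) < +oo)%E.
  elim: n => [|n IH]; first by rewrite [X in (X < _)%E]fE ltry.
  apply: le_lt_trans (hC psi n mpsi) _; apply: lte_mul_pinfty => //.
  by rewrite lee_fin mulr_ge0// powR_ge0.
pose a n := fine (sqnormL2 (cmu n) (psi n)).
have aE n : sqnormL2 (cmu n) (psi n) = (a n)%:E by exact: sqnormL2_fin.
have a0 n : 0 <= a n by apply: fine_ge0; exact: sqnormL2_ge0.
have arec n : a n.+1 <= 0 + C * n.+1%:R `^ (- dl) * a n.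
  rewrite add0r -lee_fin EFinM -(aE n) -(aE n.+1); exact: hC.
have [N hN] := powR_decay C0 dl0.
have [B hB] : exists B, forall K, \sum_(0 <= n < K) a n <= B.
  apply: (@recursion_bounded R a (fun=> 0) _ 0 N a0 _ arec hN) => // K.
  by rewrite big1.
have hpsi : hilbert psi.
  apply: (@hilbert_of_sums _ _ _ psi a B mpsi _ _ hB) => [n s|n].
    by apply: aeW => -[P K]; exact: iterG_permute.
  by rewrite aE.
exists psi; split; last first.
  move=> [_ psi0]; have := (sqnormL2_eq0 (cmu 0%N) mf).2 (psi0 0%N).
  by rewrite fE => -[] /eqP; rewrite !expf_eq0 pnatr_eq0/= !andbF.
pose phi : fock R d M := fun n X => psi n X - G psi X.
have phiS n (X : cfg n.+1) : phi n.+1 X = 0 by rewrite /phi /psi iterGS subrr.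
have phi0E : phi 0%N = f by apply/funext => X; rewrite /phi /= subr0.
suff : hilbert phi /\ hilbert (multiplication (@symbolL R d M omega) phi).
  by move=> hphi; split; [exact: hpsi|exact: hphi].
split.
  by apply: vacuum_hilbert phiS _; rewrite phi0E// fE ltry.
have mLf : cmeasurable (multiplication (@symbolL R d M omega) phi (n := 0)).
  apply: cmeasurable_mul; first exact: (cmeasurable_real (@mL 0)).
  by rewrite -[X in cmeasurable X]/(phi 0%N) phi0E.
apply: (vacuum_hilbert mLf).
  by move=> n X; rewrite /multiplication phiS mulr0.
(* On the box each of the M d coordinates has absolute value at most 1, so L is at most M d. *)
pose c : R := (M%:R * d%:R) ^+ 2.
have := @sqnormL2_le _ _ _ (cmu 0%N) (multiplication (@symbolL R d M omega) phi (n := 0)) f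
  c (sqr_ge0 _) mLf mf.
rewrite fE -EFinM => H; apply: le_lt_trans (H _) (ltry _) => X.
rewrite /multiplication sqr_normc_scale -/(phi 0%N X) phi0E /f normc_real indicE.
have [XA|XA] := boolP (X \in vacuum_box); last by rewrite normr0 expr0n/= !mulr0.
rewrite normr1 expr1n !mulr1; apply: lerXn2r; rewrite ?nnegrE ?mulr_ge0//.
rewrite /symbolL big_ord0 addr0 -[M in leRHS]card_ord mulr_natl -sumr_const.
apply: ler_sum => l _; rewrite sqnormE -[d in leRHS]card_ord -sumr_const.
apply: ler_sum => i _; rewrite -(expr1n _ 2) -real_normK ?num_real//.
by apply: lerXn2r; rewrite ?nnegrE//; move: XA; rewrite inE; apply.
Qed.

End nonzero_element.

End main.

(** * Condition (C) and the equivalence *)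

(** In case (1) beta >= 0 suffices. In case (2), d = 1 leaves a margin of 1/2, d = 2 uses beta > 0,
    and d = 3 reduces to beta^2 / (8 + beta^2) <= beta / 2. *)
Lemma condition_gap (R : realType) d (vhat : Rd R d -> R[i]) (omega : Rd R d -> R)
    (alpha beta : R) : (1 <= d <= 3)%N ->
  condition_parameters vhat omega alpha beta -> d%:R / 2 < alpha + beta / 2 + 1.
Proof.
move=> hd [[a0 ad b0 b2] [|[_ h2 h3]]]; first by have := divr_ge0 b0 (ler0n R 2); lra.
have [d1|d2|d3] : [\/ d = 1%N, d = 2%N | d = 3%N].
  by case: d hd {ad h2 h3 vhat omega} => [|[|[|[|]]]]// _; [constructor 1|constructor 2|constructor 3].
- by rewrite d1; lra.
- by have [-> b] := h2 d2; rewrite d2; lra.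
have := h3 d3; rewrite d3.
have p : 0 < 8 + beta ^+ 2 by rewrite ltr_pwDl// sqr_ge0.
have : beta ^+ 2 / (8 + beta ^+ 2) <= beta / 2.
  rewrite ler_pdivrMr// -subr_ge0.
  (* Completing the square: 8 + beta^2 - 2 beta = (beta - 1)^2 + 7. *)
  have -> : beta / 2 * (8 + beta ^+ 2) - beta ^+ 2 =
    beta / 2 * ((beta - 1) ^+ 2 + 7) by field.
  by apply: mulr_ge0; [exact: divr_ge0|rewrite addr_ge0// sqr_ge0].
lra.
Qed.

Theorem corollary1p5 (R : realType) (d M : nat)
  (hd : (1 <= d <= 3)%N) (hM : (1 <= M)%N)
  (g : R) (hg : g != 0)
  (v : (Rd R d -> R[i]) -> R[i]) (vhat : Rd R d -> R[i])
  (omega : Rd R d -> R) (alpha beta : R)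
  (hC : conditionC v vhat omega alpha beta)
  (hloc : locally_bounded omega) :
  (domH M omega g vhat `<=` domLhalf M omega <->
     (form_integral vhat omega < +oo)%E) /\
  (form_integral vhat omega = +oo%E ->
     domH M omega g vhat `&` domLhalf M omega = zero_class R d M).
Proof.
have [_ [mvhat _] _ [momega _] [vhat_le omega_ge hpar]] := hC.
have gap := condition_gap hd hpar.
have [[a0 ad b0 _] hcases] := hpar.
have zero := domH_domLhalf_zero mvhat momega vhat_le omega_ge a0 ad b0 gap
  (Ordinal hM) hg.
split; last exact: zero.
split=> [sub|fin].
  (* Under divergence the inclusion would force every element of D(H) to be zero, against
     [iterG_in_domH]. *)
  rewrite ltey; apply/eqP => foo.
  have [psi [psiH]] := iterG_in_domH M g mvhat momega vhat_le omega_ge a0 ad b0 gap.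
  by apply; rewrite -(zero foo); split; [|exact: sub].
apply: domH_domLhalf mvhat momega vhat_le omega_ge a0 ad b0 gap _.
(* Case (2) of Condition (C) includes divergence, so finiteness leaves alpha > d/2 - 1. *)
case: hcases => [|[foo _ _]]; first by lra.
by move: fin; rewrite foo ltxx.
Qed.
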